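(* Let $H\in(0,1)$, let $B=\{B_t,t\ge 0\}$ be a one-dimensional fractional Brownian motion with Hurst parameter $H$, and let $X_t=\int_0^t \mathrm{sign}(B_s)\,dB_s$, $t\ge 0$, where the stochastic integral is the (extended) divergence integral with respect to $B$. Then $X=\{X_t,t\ge0\}$ is $H$-self-similar, that is, for all $a>0$ the processes $\{X_{at},t\ge0\}$ and $\{a^HX_t,t\ge0\}$ have the same law.
   Context: A fractional Brownian motion with Hurst parameter $H\in(0,1)$ is a zero mean Gaussian process $B=\{B_t,t\ge0\}$ with covariance $R_H(t,s)=E(B_tB_s)=\frac12(s^{2H}+t^{2H}-|t-s|^{2H})$. Random variables are taken measurable with respect to the $\sigma$-field generated by $B$. Divergence integral. Fix $T>0$. $\mathcal H$ is the closure of the step functions on $[0,T]$ for the scalar product $\langle \mathbf 1_{[0,t]},\mathbf 1_{[0,s]}\rangle_{\mathcal H}=R_H(t,s)$, and $\varphi\mapsto B(\varphi)$ is the isometry from $\mathcal H$ onto the Gaussian space of $B$ with $B(\mathbf 1_{[0,t]})=B_t$. Let $K_H(t,s)$ be the square integrable (Volterra) kernel with $R_H(t,s)=\int_0^{t\wedge s}K_H(t,u)K_H(s,u)\,du$, let $K_H^*$ be the linear isometry from $\mathcal H$ onto $L^2(0,T)$ extending $(K_H^*\mathbf 1_{[0,t]})(s)=K_H(t,s)\mathbf 1_{[0,t]}(s)$, and $K_H^{*,a}$ its adjoint (with respect to the $L^2(0,T)$ inner product). Put $\mathcal H_2=(K_H^* )^{-1}(K_H^{*,a})^{-1}(L^2(0,T))$.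 Explicitly, for $\varphi\in\mathcal H_2$, $\psi=K_H^{*,a}K_H^*\varphi$ is the function in $L^2(0,T)$ with $\int_0^r\psi(s)\,ds=\langle\varphi,\mathbf 1_{[0,r]}\rangle_{\mathcal H}$ for all $r\in[0,T]$. Let $\mathcal S_{\mathcal H}$ be the set of random variables $F=f(B(\phi_1),\dots,B(\phi_n))$ with $n\ge1$, $f\in C_b^\infty(\mathbb R^n)$ ($f$ and all partial derivatives bounded), $\phi_i\in\mathcal H_2$, and $DF=\sum_i \partial_if(B(\phi_1),\dots,B(\phi_n))\phi_i$. A measurable process $u$ with $E\int_0^Tu_t^2dt<\infty$ belongs to the extended domain $\mathrm{Dom}_T^*\delta$ if there is $\delta(u)\in L^2(\Omega)$ with $\int_0^T E(u_t\,K_H^{*,a}K_H^*D_tF)\,dt=E(\delta(u)F)$ for all $F\in\mathcal S_{\mathcal H}$. It is known that for every $H\in(0,1)$ and $t>0$ the process $\mathrm{sign}(B_s)$, $s\in[0,t]$, belongs to $\mathrm{Dom}_t^*\delta$; $\int_0^t\mathrm{sign}(B_s)\,dB_s$ denotes its divergence $\delta$ on $[0,t]$. *)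

(* Defs.v *)
(* MathComp-Analysis world. *)
From HB Require Import structures.
From mathcomp Require Export all_boot all_order all_algebra.
From mathcomp Require Export all_classical all_reals all_analysis.

Set Implicit Arguments.
Unset Strict Implicit.
Unset Printing Implicit Defensive.

Import Order.TTheory GRing.Theory Num.Theory.
Import numFieldNormedType.Exports.

Local Open Scope classical_set_scope.
Local Open Scope ring_scope.

Definition fbm_cov (R : realType) (H t s : R) : R :=
  2^-1 * (s `^ (2 * H) + t `^ (2 * H) - `|t - s| `^ (2 * H)).

Section fractional_brownian_motion.
Context (R : realType) (d : measure_display) (Omega : measurableType d)
  (P : probability Omega R).

(* Standard deviation [s = 0] is the degenerate (Dirac) Gaussian law, for which
   [normal_prob] takes a junk value. *)
Definition gaussian_rv (Z : Omega -> R) : Prop :=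
  exists m s : R, 0 <= s /\ forall A : set R, measurable A ->
    P (Z @^-1` A) = if s == 0 then \d_m A else normal_prob m s A.

(* Processes indexed by [0, +oo[ are families over R of which only the
   members of nonnegative index are ever constrained or used. *)
Record is_fbm (H : R) (B : R -> {RV P >-> R}) : Prop := IsFbm {
  fbm_gaussian : forall (n : nat) (t c : 'I_n -> R), (forall i, 0 <= t i) ->
    gaussian_rv (fun w => \sum_(i < n) c i * B (t i) w);
  fbm_mean : forall t, 0 <= t -> ('E_P[B t] = 0)%E;
  fbm_covE : forall t s, 0 <= t -> 0 <= s ->
    ('E_P[fun w => (B t w * B s w)%R] = (fbm_cov H t s)%:E)%E }.

Definition sigma_field_upto (B : R -> {RV P >-> R}) (T : R) : set (set Omega) :=
  <<s \bigcup_(s in `[0, T]) preimage_set_system setT (B s) measurable >>.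

End fractional_brownian_motion.

Section law_of_processes.
Context (R : realType) (d : measure_display) (Omega : measurableType d)
  (P : probability Omega R).

(* Cylinder sigma-algebra of the path space over the index set [0, +oo[. *)
Definition cylinder_sigma : set (set (R -> R)) :=
  <<s \bigcup_(t in `[0, +oo[)
        preimage_set_system setT (fun x : R -> R => x t) measurable >>.

Definition same_law (X Y : R -> Omega -> R) : Prop :=
  forall A, cylinder_sigma A ->
    P [set w | A (fun t => X t w)] = P [set w | A (fun t => Y t w)].

Definition self_similar (H : R) (X : R -> Omega -> R) : Prop :=
  forall a, 0 < a ->
    same_law (fun t => X (a * t)) (fun t w => a `^ H * X t w).

End law_of_processes.

Section hilbert_space_of_steps.
Context (R : realType).
Local Notation mu := (@lebesgue_measure R).

Definition L2on (T : R) (f : R -> R) : Prop :=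
  measurable_fun `[0, T] f /\ (\int[mu]_(x in `[0%R, T]) (f x ^+ 2)%:E < +oo)%E.

(* [:: (c_1, t_1); ...; (c_k, t_k)] stands for
   c_1 1_[0, t_1] + ... + c_k 1_[0, t_k]. *)
Definition step : Type := seq (R * R).

Definition step_on (T : R) (g : step) : Prop :=
  forall p, p \in g -> 0 <= p.2 <= T.

Definition step_fun (g : step) (x : R) : R :=
  \sum_(p <- g) p.1 * \1_(`[0, p.2]) x.

Definition step_sub (g1 g2 : step) : step := g1 ++ [seq (- p.1, p.2) | p <- g2].

Definition step_ip (H : R) (g1 g2 : step) : R :=
  \sum_(p <- g1) \sum_(q <- g2) p.1 * q.1 * fbm_cov H p.2 q.2.

(* The closure of the step functions is their Hilbert completion (for H > 1/2
   it is not a space of functions): an element is represented by a Cauchy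
   sequence of step functions. *)
Definition calH (H T : R) (phi : nat -> step) : Prop :=
  (forall n, step_on T (phi n)) /\
  (forall e : R, 0 < e -> exists N : nat, forall m n : nat,
     (N <= m)%N -> (N <= n)%N ->
     step_ip H (step_sub (phi m) (phi n)) (step_sub (phi m) (phi n)) < e).

Record volterra_kernel (H : R) (K : R -> R -> R) : Prop := VolterraKernel {
  kernel_L2 : forall t, 0 <= t -> L2on t (K t);
  kernel_cov : forall t s, 0 <= t -> 0 <= s ->
    \int[mu]_(u in `[0, Num.min t s]) (K t u * K s u) = fbm_cov H t s }.

Definition Kstar_step (K : R -> R -> R) (g : step) (s : R) : R :=
  \sum_(p <- g) p.1 * (K p.2 s * \1_(`[0, p.2]) s).

(* h = K_H^* phi, by isometric extension. The factorization does not determine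
   the kernel (K(t, s) can be multiplied by a sign depending on s), but
   K_H^{*,a} K_H^* does not depend on the choice. *)
Definition is_Kstar (K : R -> R -> R) (T : R) (phi : nat -> step) (h : R -> R)
    : Prop :=
  L2on T h /\
  (fun n => \int[mu]_(s in `[0%R, T]) ((h s - Kstar_step K (phi n) s) ^+ 2)%:E)%E
    @ \oo --> 0%E.

(* h belongs to the domain of the L^2(0, T)-adjoint of K_H^* and
   psi = K_H^{*,a} h. K_H^* is an unbounded operator of L^2(0, T) when H < 1/2
   and a bounded one when H > 1/2; in both cases the step functions form a core,
   so it is enough to test against them. *)
Definition is_Kstar_adj (K : R -> R -> R) (T : R) (h psi : R -> R) : Prop :=
  L2on T psi /\
  forall g, step_on T g ->
    \int[mu]_(s in `[0, T]) (psi s * step_fun g s)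
    = \int[mu]_(s in `[0, T]) (h s * Kstar_step K g s).

Definition is_KstaraKstar (K : R -> R -> R) (T : R) (phi : nat -> step)
    (psi : R -> R) : Prop :=
  exists2 h, is_Kstar K T phi h & is_Kstar_adj K T h psi.

Definition calH2 (H : R) (K : R -> R -> R) (T : R) (phi : nat -> step) : Prop :=
  calH H T phi /\ exists psi, is_KstaraKstar K T phi psi.

Definition partial (n : nat) (i : 'I_n.+1) (f : 'rV[R]_n.+1 -> R)
    : 'rV[R]_n.+1 -> R := 'D_(delta_mx 0 i) f.

Definition iter_partial (n : nat) (s : seq 'I_n.+1) (f : 'rV[R]_n.+1 -> R)
    : 'rV[R]_n.+1 -> R := foldr (@partial n) f s.

(* C_b^oo(R^(n+1)): existence and boundedness of all the iterated partial
   derivatives makes each of them Lipschitz, hence f smooth. *)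
Definition Cb_infty (n : nat) (f : 'rV[R]_n.+1 -> R) : Prop :=
  forall s : seq 'I_n.+1,
    (forall x i, derivable (iter_partial s f) x (delta_mx 0 i)) /\
    (exists M : R, forall x, `|iter_partial s f x| <= M).

End hilbert_space_of_steps.

Section divergence.
Context (R : realType) (d : measure_display) (Omega : measurableType d)
  (P : probability Omega R).
Local Notation mu := (@lebesgue_measure R).
Implicit Type B : R -> {RV P >-> R}.

Definition step_integral B (g : step R) (w : Omega) : R :=
  \sum_(p <- g) p.1 * B p.2 w.

(* Z is a version of B(phi), by isometric extension. *)
Definition is_wiener_integral B (phi : nat -> step R) (Z : {RV P >-> R})
    : Prop :=
  (fun n => 'E_P[fun w => ((Z w - step_integral B (phi n) w) ^+ 2)%R])%E
    @ \oo --> 0%E.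

(* For F = f(B(phi_0), ..., B(phi_n)) with B(phi_i) = Z_i and
   psi_i = K_H^{*,a} K_H^* phi_i, the two following random variables are F and
   K_H^{*,a} K_H^* D_t F, the latter by linearity. *)
Definition smooth_rv (n : nat) (f : 'rV[R]_n.+1 -> R)
    (Z : 'I_n.+1 -> {RV P >-> R}) (w : Omega) : R :=
  f (\row_i Z i w).

Definition KKD (n : nat) (f : 'rV[R]_n.+1 -> R)
    (Z : 'I_n.+1 -> {RV P >-> R}) (psi : 'I_n.+1 -> R -> R) (t : R) (w : Omega)
    : R :=
  \sum_(i < n.+1) partial i f (\row_j Z j w) * psi i t.

(* u belongs to Dom_T^* delta and delta(u) = D. The divergence on [0, T] is
   built on the process B restricted to [0, T]: L^2(Omega) is taken with respect
   to the sigma-field it generates, without which D would not be determined. *)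
Record is_divergence (H : R) (K : R -> R -> R) B (T : R)
    (u : R -> Omega -> R) (D : {RV P >-> R}) : Prop := IsDivergence {
  div_process_measurable :
    measurable_fun (`[0, T] `*` setT) (fun p : R * Omega => u p.1 p.2);
  div_process_L2 :
    (\int[P]_w \int[mu]_(t in `[0%R, T]) (u t w ^+ 2)%:E < +oo)%E;
  div_measurable :
    preimage_set_system setT D measurable `<=` sigma_field_upto B T;
  div_L2 : (D : Omega -> R) \in Lfun P 2%:E;
  div_duality : forall (n : nat) (f : 'rV[R]_n.+1 -> R)
      (phi : 'I_n.+1 -> nat -> step R) (Z : 'I_n.+1 -> {RV P >-> R})
      (psi : 'I_n.+1 -> R -> R),
    Cb_infty f ->
    (forall i, calH2 H K T (phi i)) ->
    (forall i, is_wiener_integral B (phi i) (Z i)) ->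
    (forall i, is_KstaraKstar K T (phi i) (psi i)) ->
    (\int[mu]_(t in `[0%R, T]) 'E_P[fun w => (u t w * KKD f Z psi t w)%R]
     = 'E_P[fun w => (D w * smooth_rv f Z w)%R])%E }.

End divergence.

(* Main.v *)
From HB Require Import structures.
Require Import Defs.
From mathcomp Require Import measurable_realfun zify ring lra.
Import Order.TTheory GRing.Theory Num.Theory.
Import numFieldNormedType.Exports.
Local Open Scope classical_set_scope.
Local Open Scope ring_scope.

Set Implicit Arguments.
Unset Strict Implicit.
Unset Printing Implicit Defensive.

(** Let a > 0 and V_t = a^(-H) B_(a t). The process V is again a fractional
    Brownian motion with Hurst parameter H, so V and B have the same law. The
    variable X_t is a functional of B on [0, t] that the duality relation on
    [0, t] characterizes. When time is multiplied by a, a test element phi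
    becomes phi(./a), its Wiener integral is multiplied by a^H in law, and its
    image under K_H^{*,a} K_H^* becomes a^(2H-1) times the old one at s/a; since
    sign(B_(a u)) = sign(V_u), the substitution s = a u turns the duality
    relation of X_(a t) into the one that a^H X_t satisfies, with V in the place
    of B. So X_(a t) depends on V as a^H X_t depends on B, and the two processes
    have the same law.

    Moments. It is enough to test with F = cos (B(phi) + th), where B(phi) is a
    single Wiener integral. Instead of Fourier inversion, the family of
    functions of a path on which two expectations agree is seen to contain these
    cosines and to be stable under linear combinations and bounded pointwise
    limits; the smallest such family, [trig_class], is an algebra and contains
    the indicators of all cylinder events ([trig_indic]).

    Test elements. The indicators 1_[0,t] are in H_2 only when H > 1/4. The
    averages over s in [0, 1] of
       1_[0, (1 - eta) t + eta T s] - 1_[0, eta T s]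
    are in H_2 for every H: the derivative of r |-> E (Z B_r), for Z the Wiener
    integral of the average, is an explicit bounded function, [test_density],
    because averaging integrates the singularities |t - r|^(2H-1) and the
    subtraction cancels r^(2H-1). The average is a limit of Riemann sums, which
    are step functions; its Wiener integral and its image under K_H^* exist by
    completeness of L^2 ([RieszFischer], [smooth_limit]), and the adjoint
    relation [smooth_KstaraKstar] is the convergence of Riemann sums of the
    covariance to its primitive. The averages tend to 1_[0,t] when eta tends to
    0, so that the relation between X_(a t) and a^H X_t passes to the cosines of
    linear combinations of the values of the processes
    ([divergence_step_cos]).

    From moments to laws. If E (W1 F(V)) = E (W2 F(B)) for all F, the event
    W1 < y is, up to a null set, the same event in terms of V as W2 < y is in
    terms of B ([halfline_events_agree]). The cylinder sets for which this
    correspondence holds form a sigma-algebra, which gives the equality of the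
    laws ([same_law_functionals]). *)

(** * Square-integrable functions *)

Section square_integrable.
Context (d : measure_display) (T : measurableType d) (R : realType)
  (mu : {measure set T -> \bar R}) (D : set T) (mD : measurable D).

Implicit Types f g h : T -> R.

(** With mu the Lebesgue measure and D = [0, T], this is [L2on]. *)
Definition sqint (f : T -> R) : Prop :=
  measurable_fun D f /\ (\int[mu]_(x in D) (f x ^+ 2)%:E < +oo)%E.

Definition ip (f g : T -> R) : R := \int[mu]_(x in D) (f x * g x).

Lemma sqint_integrable f : sqint f -> mu.-integrable D (fun x => (f x ^+ 2)%:E).
Proof.
move=> [mf foo]; apply/integrableP; split.
  by apply/measurable_EFinP; exact: measurable_funX.
rewrite (le_lt_trans _ foo)//.
by under eq_integral do rewrite gee0_abs ?lee_fin ?sqr_ge0//.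
Qed.

Lemma integrable_sqint f : measurable_fun D f ->
  mu.-integrable D (fun x => (f x ^+ 2)%:E) -> sqint f.
Proof.
move=> mf /integrableP[_ foo]; split => //; rewrite (le_lt_trans _ foo)//.
by under [leRHS]eq_integral do rewrite gee0_abs ?lee_fin ?sqr_ge0//.
Qed.

Lemma sqint_mul f g : sqint f -> sqint g ->
  mu.-integrable D (fun x => (f x * g x)%:E).
Proof.
move=> hf hg; have := integrableD mD (sqint_integrable hf) (sqint_integrable hg).
apply: le_integrable => //.
  by apply/measurable_EFinP; apply: measurable_funM; [case: hf|case: hg].
move=> x _ /=; rewrite lee_fin [leRHS]ger0_norm ?addr_ge0 ?sqr_ge0//.
by rewrite ler_norml; apply/andP; split; nra.
Qed.

Lemma sqint0 : sqint (fun=> 0).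
Proof.
split; first exact: measurable_cst.
under eq_integral do rewrite expr0n/=.
by rewrite integral0 ltry.
Qed.

Lemma sqintZ a f : sqint f -> sqint (fun x => a * f x).
Proof.
move=> hf; apply: integrable_sqint; first by apply: measurable_funM => //; case: hf.
under eq_fun do rewrite exprMn EFinM.
by apply: integrableZl => //; exact: sqint_integrable.
Qed.

Lemma sqintD f g : sqint f -> sqint g -> sqint (fun x => f x + g x).
Proof.
move=> hf hg; apply: integrable_sqint.
  by apply: measurable_funD; [case: hf|case: hg].
have -> : (fun x => ((f x + g x) ^+ 2)%:E) =
    (fun x => ((f x ^+ 2)%:E + (2 * (f x * g x))%:E + (g x ^+ 2)%:E)%E).
  by apply/funext => x; rewrite -!EFinD; congr EFin; ring.
apply: integrableD => //; last exact: sqint_integrable.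
apply: integrableD => //; first exact: sqint_integrable.
under eq_fun do rewrite EFinM.
by apply: integrableZl => //; exact: sqint_mul.
Qed.

Lemma sqintB f g : sqint f -> sqint g -> sqint (fun x => f x - g x).
Proof.
move=> hf hg; have := sqintD hf (sqintZ (-1) hg).
by under eq_fun do rewrite mulN1r.
Qed.

Lemma sqint_sum (I : eqType) (s : seq I) (F : I -> T -> R) :
  (forall i, i \in s -> sqint (F i)) -> sqint (fun x => \sum_(i <- s) F i x).
Proof.
elim: s => [_|i s IH h].
  by under eq_fun do rewrite big_nil; exact: sqint0.
under eq_fun do rewrite big_cons.
apply: sqintD; first by apply: h; rewrite mem_head.
by apply: IH => j js; apply: h; rewrite in_cons js orbT.
Qed.

Lemma ipC f g : ip f g = ip g f.
Proof. by apply: eq_Rintegral => x _; rewrite mulrC. Qed.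

Lemma ipDl f g h : sqint f -> sqint g -> sqint h ->
  ip (fun x => f x + g x) h = ip f h + ip g h.
Proof.
move=> hf hg hh; rewrite /ip -RintegralD//; last 2 first.
- exact: sqint_mul.
- exact: sqint_mul.
by apply: eq_Rintegral => x _; rewrite mulrDl.
Qed.

Lemma ipZl a f g : sqint f -> sqint g -> ip (fun x => a * f x) g = a * ip f g.
Proof.
move=> hf hg; rewrite /ip -RintegralZl//; last exact: sqint_mul.
by apply: eq_Rintegral => x _; rewrite mulrA.
Qed.

Lemma ipBl f g h : sqint f -> sqint g -> sqint h ->
  ip (fun x => f x - g x) h = ip f h - ip g h.
Proof.
move=> hf hg hh; rewrite /ip -RintegralB//; last 2 first.
- exact: sqint_mul.
- exact: sqint_mul.
by apply: eq_Rintegral => x _; rewrite mulrBl.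
Qed.

Lemma ip_suml (I : eqType) (s : seq I) (F : I -> T -> R) g :
  (forall i, i \in s -> sqint (F i)) -> sqint g ->
  ip (fun x => \sum_(i <- s) F i x) g = \sum_(i <- s) ip (F i) g.
Proof.
move=> + hg; elim: s => [_|i s IH h].
  under [X in ip X]eq_fun do rewrite big_nil.
  rewrite big_nil /ip; under eq_Rintegral do rewrite mul0r.
  by rewrite Rintegral_cst// mul0r.
under [X in ip X]eq_fun do rewrite big_cons.
rewrite ipDl//; last 2 first.
- by apply: h; rewrite mem_head.
- by apply: sqint_sum => j js; apply: h; rewrite in_cons js orbT.
by rewrite big_cons IH// => j js; apply: h; rewrite in_cons js orbT.
Qed.

Lemma ip_ge0 f : 0 <= ip f f.
Proof. by apply: Rintegral_ge0 => x _; rewrite -expr2 sqr_ge0. Qed.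

Lemma ip_integral f : sqint f ->
  (\int[mu]_(x in D) (f x ^+ 2)%:E = (ip f f)%:E)%E.
Proof.
move=> hf; rewrite /ip /Rintegral.
under [in RHS]eq_integral do rewrite -expr2.
by rewrite fineK//; exact: integrable_fin_num (sqint_integrable hf).
Qed.

(** Nonnegativity of the quadratic polynomial ip (f - t g) (f - t g) in t. *)
Lemma ip_CauchySchwarz f g : sqint f -> sqint g -> ip f g ^+ 2 <= ip f f * ip g g.
Proof.
move=> hf hg.
have quad t : 0 <= ip f f - 2 * t * ip f g + t ^+ 2 * ip g g.
  have hgt := sqintZ t hg; have hfg := sqintB hf hgt.
  have := ip_ge0 (fun x => f x - t * g x).
  rewrite ipBl// (ipC f) (ipC (fun x => t * g x)) !ipBl// !(ipC _ (fun x => t * g x)).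
  rewrite !ipZl// (ipC g f).
  by rewrite (ipC g (fun x => t * g x)) ipZl//; nra.
have [g0|g0] := eqVneq (ip g g) 0.
  rewrite g0 mulr0; move: quad; rewrite g0 => quad.
  have [->|fg0] := eqVneq (ip f g) 0; first by rewrite expr0n.
  (* the polynomial is then affine with nonzero slope, hence negative somewhere *)
  exfalso; have := quad ((ip f f + 1) / (2 * ip f g)).
  have -> : 2 * ((ip f f + 1) / (2 * ip f g)) * ip f g = ip f f + 1 by field.
  by lra.
have gp : 0 < ip g g by rewrite lt_neqAle eq_sym g0 ip_ge0.
have := quad (ip f g / ip g g).
have -> : ip f f - 2 * (ip f g / ip g g) * ip f g + (ip f g / ip g g) ^+ 2 * ip g g
  = (ip f f * ip g g - ip f g ^+ 2) / ip g g by field.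
by rewrite pmulr_lge0 ?invr_gt0// subr_ge0.
Qed.

End square_integrable.

(** The sequence is the sum of its increments, a normally convergent series. *)
Lemma cvg_geometric_increments (R : realType) (u : R ^nat) (M p : R) :
  0 <= p < 1 -> (forall n, `|u n.+1 - u n| <= M * p ^+ n) -> cvgn u.
Proof.
move=> /andP[p0 p1] h; have M0 : 0 <= M.
  by have := h 0%N; rewrite expr0 mulr1; apply: le_trans.
have : cvgn (series (fun n => u n.+1 - u n)).
  apply: normed_cvg; apply: (@series_le_cvg _ _ (geometric M p)) => //.
  - by move=> n /=.
  - by move=> n; rewrite /geometric /= mulr_ge0// exprn_ge0.
  - by apply: is_cvg_geometric_series; rewrite ger0_norm.
move=> cs.
have -> : u = (fun n => u 0%N + series (fun n => u n.+1 - u n) n).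
  apply/funext => n; rewrite /series /=.
  by rewrite telescope_sumr// addrC subrK.
by apply: is_cvgD => //; exact: is_cvg_cst.
Qed.

Section RieszFischer.
Context (d : measure_display) (T : measurableType d) (R : realType)
  (mu : {measure set T -> \bar R}) (D : set T) (mD : measurable D).
Local Notation sq := (sqint mu D).
Local Notation N2 f := (ip mu D f f).
Variables (f : nat -> T -> R) (C p : R).
Hypotheses (p01 : 0 < p < 1) (sqf : forall n, sq (f n)).
Hypothesis cauchyf : forall n m, (n <= m)%N ->
  N2 (fun x => f m x - f n x) <= C * (p ^+ 4) ^+ n.

(** Dividing the squared increments by p ^ 2n leaves them with summable
    integrals, while their boundedness at a point makes the increments there a
    O(p ^ n). The ratio of the hypothesis is p ^ 4 because this costs one square
    root and the passage from squares to increments another. *)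
Let weight n x := ((f n.+1 x - f n x) ^+ 2 / (p ^+ 2) ^+ n)%:E.

Let p0 : 0 < p. Proof. by case/andP: p01. Qed.
Let p1 : p < 1. Proof. by case/andP: p01. Qed.

Let C0 : 0 <= C.
Proof. by have := cauchyf (leqnn 0); rewrite expr0 mulr1; apply/le_trans/ip_ge0. Qed.

Let weight_ge0 n x : (0 <= weight n x)%E.
Proof. by rewrite lee_fin divr_ge0 ?sqr_ge0// exprn_ge0// sqr_ge0. Qed.

Let mweight n : measurable_fun D (weight n).
Proof.
apply/measurable_EFinP; apply: measurable_funM => //.
by apply: measurable_funX; apply: measurable_funB; [case: (sqf n.+1)|case: (sqf n)].
Qed.

Let weight_int n : (\int[mu]_(x in D) weight n x <= (C * (p ^+ 2) ^+ n)%:E)%E.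
Proof.
have pn : 0 < (p ^+ 2) ^+ n by rewrite !exprn_gt0.
have sB : sq (fun x => f n.+1 x - f n x) by exact: sqintB.
rewrite /weight; under eq_integral do rewrite mulrC EFinM.
rewrite ge0_integralZl//; last 3 first.
- apply/measurable_EFinP; apply: measurable_funX; by case: sB.
- by move=> x _; rewrite lee_fin sqr_ge0.
- by rewrite lee_fin invr_ge0 ltW.
rewrite ip_integral// -EFinM lee_fin.
rewrite ler_pdivrMl//; apply: (le_trans (cauchyf (leqnSn n))).
by rewrite mulrCA -exprMn -exprD.
Qed.

Let series_finite : (\int[mu]_(x in D) (\sum_(n <oo) weight n x) < +oo)%E.
Proof.
rewrite integral_nneseries//.
apply: (@le_lt_trans _ _ (\sum_(n <oo) (geometric C (p ^+ 2) n)%:E)%E).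
  by apply: lee_nneseries => // n _ _; exact: integral_ge0.
have cg : cvgn (series (geometric C (p ^+ 2))).
  apply: is_cvg_geometric_series; rewrite ger0_norm ?sqr_ge0//.
  by rewrite expr_lt1// ltW.
have -> : (fun n => \sum_(0 <= k < n) (geometric C (p ^+ 2) k)%:E)%E =
    EFin \o series (geometric C (p ^+ 2)).
  by apply/funext => n; rewrite /series /= sumEFin.
by rewrite EFin_lim// ltry.
Qed.

Let ae_cvg : {ae mu, forall x, D x -> cvgn (f ^~ x)}.
Proof.
have mS : measurable_fun D (fun x => \sum_(n <oo) weight n x)%E.
  by apply: ge0_emeasurable_sum => //.
have iS : mu.-integrable D (fun x => \sum_(n <oo) weight n x)%E.
  apply/integrableP; split => //; rewrite (le_lt_trans _ series_finite)//.
  by under eq_integral do rewrite gee0_abs ?nneseries_ge0//.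
have := integrable_ae mD iS; apply: filterS => x h /h {h} fin.
pose M := fine (\sum_(n <oo) weight n x)%E.
apply: (@cvg_geometric_increments _ _ (Num.sqrt M) p); first by rewrite ltW//=.
move=> n; have pn : 0 < p ^+ n by rewrite exprn_gt0.
have : ((f n.+1 x - f n x) ^+ 2 / (p ^+ 2) ^+ n <= M).
  rewrite -lee_fin fineK//.
  have := @nneseries_lim_ge R (weight ^~ x) xpredT 0 n.+1 (fun n _ _ => weight_ge0 n x).
  apply: le_trans.
  by rewrite big_nat_recr//= leeDr// sume_ge0.
rewrite ler_pdivrMr ?exprn_gt0// => h.
rewrite -[leLHS]sqrtr_sqr -(ger0_norm (ltW pn)) -[X in _ * X]sqrtr_sqr.
have M0 : 0 <= M by rewrite fine_ge0// nneseries_ge0.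
by rewrite -sqrtrM// ler_wsqrtr// (le_trans h)// exprAC.
Qed.

(** The increments are almost everywhere summable, so the sequence converges
    almost everywhere, and Fatou's lemma transfers the Cauchy estimate to the
    limit. *)
Lemma RieszFischer : exists2 g, sq g &
  forall n, N2 (fun x => g x - f n x) <= C * (p ^+ 4) ^+ n.
Proof.
pose g x := fine (limn_esup (fun n => (f n x)%:E)).
have mg : measurable_fun D g.
  apply: measurableT_comp => //.
  by apply: measurable_fun_limn_esup => // n; apply/measurable_EFinP; case: (sqf n).
have gE x : cvgn (f ^~ x) -> f ^~ x @ \oo --> g x.
  move=> cf; have := cf.
  have e : (EFin \o f ^~ x) @ \oo --> (limn (f ^~ x))%:E.
    by apply: cvg_EFin => //; exact: nearW.
  by rewrite /g (cvg_limn_einf_sup e).2.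
have bound n : (\int[mu]_(x in D) ((g x - f n x) ^+ 2)%:E <= (C * (p ^+ 4) ^+ n)%:E)%E.
  pose h m x := ((f (m + n)%N x - f n x) ^+ 2)%:E.
  have mh m : measurable_fun D (h m).
    apply/measurable_EFinP; apply: measurable_funX; apply: measurable_funB.
      by case: (sqf (m + n)%N).
    by case: (sqf n).
  have h0 m x : D x -> (0 <= h m x)%E by rewrite lee_fin sqr_ge0.
  rewrite (@ge0_ae_eq_integral _ _ _ mu D _ (fun x => limn_einf (h ^~ x)))//.
  - apply: (le_trans (fatou mu mD mh h0)).
    rewrite limn_einf_lim; apply: lime_le; first exact: is_cvg_einfs.
    apply: nearW => k; apply: ge_ereal_inf.
    exists (\int[mu]_(x in D) h k x)%E; first by exists k => /=.
    have sB : sq (fun x => f (k + n)%N x - f n x) by exact: sqintB.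
    by rewrite /h (ip_integral mD sB) lee_fin; exact/cauchyf/leq_addl.
  - apply/measurable_EFinP; apply: measurable_funX; apply: measurable_funB => //.
    by case: (sqf n).
  - have -> : (fun x => limn_einf (h ^~ x)) =
        (fun x => - limn_esup (fun m => - h m x))%E.
      by apply/funext => x; rewrite -[X in limn_esup X]/(-%E \o h ^~ x) limn_esupN oppeK.
    apply: measurableT_comp => //; apply: measurable_fun_limn_esup => // m.
    exact: measurableT_comp.
  - by move=> x _; rewrite lee_fin sqr_ge0.
  - move=> x Dx; rewrite limn_einf_lim; apply: lime_ge; first exact: is_cvg_einfs.
    apply: nearW => k; apply: le_ereal_inf_tmp => _ [m _ <-]; exact: h0.
  - move: ae_cvg; apply: filterS => x hx Dx; have {}hx := gE _ (hx Dx).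
    have e : (h ^~ x) @ \oo --> ((g x - f n x) ^+ 2)%:E.
      apply: cvg_EFin; first exact: nearW.
      have : (fun m => f (m + n)%N x) @ \oo --> g x by move: hx; rewrite -(cvg_shiftn n).
      move=> /(@cvgB _ _ _ _ _ _ (cst (f n x)))/(_ (cvg_cst _)) c.
      exact: (cvgM c c).
    by rewrite (cvg_limn_einf_sup e).1.
have sgB n : sq (fun x => g x - f n x).
  split; last by rewrite (le_lt_trans (bound n))// ltry.
  by apply: measurable_funB => //; case: (sqf n).
exists g.
  have := sqintD mD (sgB 0%N) (sqf 0%N).
  by under eq_fun do rewrite subrK.
by move=> n; rewrite -lee_fin -ip_integral.
Qed.

End RieszFischer.

(** * Trigonometric functions of a path and its sigma-algebra *)

Section sigma_algebras.
Context (R : realType) (T : Type).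

(** [cylinder_sigma] and [sigma_field_upto] are instances. *)
Definition generated_by (D : set R) (X : R -> T -> R) : set (set T) :=
  <<s \bigcup_(t in D) preimage_set_system setT (X t) measurable >>.

(** The half-lines generate the Borel sets of the line. *)
Lemma generated_by_sub (D : set R) (X : R -> T -> R) (S : set (set T)) :
  sigma_algebra setT S ->
  (forall t y, D t -> S [set w | X t w < y]) -> generated_by D X `<=` S.
Proof.
move=> sS hS; apply: smallest_sub => // _ [t Dt] [Y mY <-].
have : sigma_algebra setT [set Y : set R | S (setT `&` X t @^-1` Y)].
  case: sS => [S0 SC SU]; split => /=.
  - by rewrite preimage_set0 setI0.
  - move=> A /SC; congr S; apply/seteqP; split => x /=; tauto.
  - move=> A /SU; congr S; rewrite preimage_bigcup setI_bigcupr //.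
move=> sY; have : RGenInftyO.G (R:=R) `<=` [set Y : set R | S (setT `&` X t @^-1` Y)].
  move=> _ [y ->] /=; rewrite setTI.
  by have := hS t y Dt; congr S; apply/seteqP; split => w /=; rewrite in_itv.
move=> /(smallest_sub sY); apply.
have : (@ocitv R).-sigma.-measurable Y by exact: mY.
by rewrite RGenInftyO.measurableE.
Qed.

Lemma generated_by_preimage (D : set R) (X : R -> T -> R) t (Y : set R) :
  D t -> measurable Y -> generated_by D X (X t @^-1` Y).
Proof.
move=> Dt mY; apply: sub_sigma_algebra; exists t => //; exists Y => //.
by rewrite setTI.
Qed.

Lemma sigma_algebra_generated_by D X : sigma_algebra setT (generated_by D X).
Proof. exact: smallest_sigma_algebra. Qed.

Lemma generated_by_mono D D' X : D `<=` D' -> generated_by D X `<=` generated_by D' X.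
Proof.
move=> DD'; apply: smallest_sub; first exact: sigma_algebra_generated_by.
move=> _ [t Dt] [Y mY <-]; rewrite setTI.
by apply: generated_by_preimage => //; exact: DD'.
Qed.

End sigma_algebras.

Section trigonometric_class.
Context (R : realType).
Implicit Types (F G : (R -> R) -> R) (g : step R) (x : R -> R) (D : set R).

Definition step_eval g x : R := \sum_(p <- g) p.1 * x p.2.

(** Stability under bounded limits is built in, so that an identity between
    expectations extends from the cosines to the class by induction, with
    dominated convergence at the limits. *)
Inductive trig_class D : ((R -> R) -> R) -> Prop :=
| trig_cos g th : (forall p, p \in g -> D p.2) ->
    trig_class D (fun x => cos (step_eval g x + th))
| trig_lin a F G : trig_class D F -> trig_class D G ->
    trig_class D (fun x => a * F x + G x)
| trig_lim (F_ : nat -> (R -> R) -> R) (M : R) F :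
    (forall n, trig_class D (F_ n)) -> (forall n x, `|F_ n x| <= M) ->
    (forall x, F_ ^~ x @ \oo --> F x) -> trig_class D F.

Context (D : set R).
Local Notation C := (trig_class D).

Lemma trig_bounded F : C F -> exists M, forall x, `|F x| <= M.
Proof.
elim=> {F} [g th _|a F G _ [M hM] _ [N hN]|F_ M F _ _ hM hF].
- by exists 1 => x; exact: cos_max.
- exists (`|a| * M + N) => x; rewrite (le_trans (ler_normD _ _))// lerD//.
  by rewrite normrM ler_wpM2l.
- exists M => x; have := hF x => /cvg_norm => h.
  by apply: (cvgr_to_le h); exact: nearW.
Qed.

Lemma trig_cst a : C (fun=> a).
Proof.
have c1 : C (fun=> 1).
  have -> : (fun=> 1) = (fun x => cos (step_eval [::] x + 0)) :> ((R -> R) -> R).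
    by apply/funext => x; rewrite /step_eval big_nil addr0 cos0.
  by apply: trig_cos => p; rewrite in_nil.
have := trig_lin (a - 1) c1 c1.
by congr C; apply/funext => x; rewrite mulr1 subrK.
Qed.

Lemma trigZ a F : C F -> C (fun x => a * F x).
Proof.
move=> cF; have := trig_lin a cF (trig_cst 0).
by under eq_fun do rewrite addr0.
Qed.

Lemma trigD F G : C F -> C G -> C (fun x => F x + G x).
Proof.
move=> cF cG; have := trig_lin 1 cF cG.
by under eq_fun do rewrite mul1r.
Qed.

Lemma trigB F G : C F -> C G -> C (fun x => F x - G x).
Proof.
move=> cF cG; have := trigD cF (trigZ (-1) cG).
by under eq_fun do rewrite mulN1r.
Qed.

Lemma step_eval_cat g h x : step_eval (g ++ h) x = step_eval g x + step_eval h x.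
Proof. by rewrite /step_eval big_cat. Qed.

Lemma step_eval_scale a g x :
  step_eval [seq (a * p.1, p.2) | p <- g] x = a * step_eval g x.
Proof. by rewrite /step_eval big_map mulr_sumr; apply: eq_bigr => p _; rewrite mulrA. Qed.

(** By the product formula for cosines for the generators, then by
    induction on each factor. *)
Lemma trigM F G : C F -> C G -> C (fun x => F x * G x).
Proof.
move=> cF cG; elim: cF => {F} [g th hg|a F F' _ h _ h'|F_ M F _ h bF cvF].
- elim: cG => {G} [g' th' hg'|a G G' _ h _ h'|G_ M G _ h bG cvG].
  + pose ng' := [seq (-1 * p.1, p.2) | p <- g'].
    have c1 : C (fun x => cos (step_eval (g ++ g') x + (th + th'))).
      apply: trig_cos => p; rewrite mem_cat => /orP[]; [exact: hg|exact: hg'].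
    have c2 : C (fun x => cos (step_eval (g ++ ng') x + (th - th'))).
      apply: trig_cos => p; rewrite mem_cat => /orP[]; first exact: hg.
      by move=> /mapP[q /hg' ? ->].
    have := trigZ 2^-1 (trigD c1 c2); congr C; apply/funext => x.
    rewrite !step_eval_cat step_eval_scale.
    set a := step_eval g x; set b := step_eval g' x.
    have -> : a + b + (th + th') = (a + th) + (b + th') by ring.
    have -> : a + -1 * b + (th - th') = (a + th) - (b + th') by ring.
    by rewrite cosB cosD; field.
  + have := trig_lin a h h'; congr C; apply/funext => x; ring.
  + apply: (@trig_lim D _ M _ h) => [n x|x]; last by apply: cvgMr.
    by rewrite normrM -[leRHS]mul1r ler_pM// cos_max.
- have := trig_lin a h h'; congr C; apply/funext => x; ring.
- have [N hN] := trig_bounded cG.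
  apply: (@trig_lim D _ (M * N) _ h) => [n x|x]; last by apply: cvgMl.
  by rewrite normrM ler_pM.
Qed.

Lemma trig_sin g th : (forall p, p \in g -> D p.2) ->
  C (fun x => sin (step_eval g x + th)).
Proof.
move=> hg; have := @trig_cos D g (th - pi / 2) hg.
by congr C; apply/funext => x; rewrite addrA cosBpihalf.
Qed.

End trigonometric_class.

(** The iterates of s |-> (3 s - s^3) / 2 push [-1, 1] towards -1, 0, 1. *)
Section sign_iteration.
Context (R : realType).
Implicit Type s : R.

Definition smoothstep s := (3 * s - s ^+ 3) / 2.

Lemma smoothstep_itv s : -1 <= s <= 1 -> -1 <= smoothstep s <= 1.
Proof.
move=> /andP[s1 s2]; rewrite /smoothstep; apply/andP; split.
  rewrite -subr_ge0 (_ : _ - _ = (1 + s) ^+ 2 * (2 - s) / 2); last by field.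
  by rewrite divr_ge0// mulr_ge0 ?sqr_ge0//; lra.
rewrite -subr_ge0 (_ : _ - _ = (1 - s) ^+ 2 * (2 + s) / 2); last by field.
by rewrite divr_ge0// mulr_ge0 ?sqr_ge0//; lra.
Qed.

Lemma iter_smoothstep_itv n s : -1 <= s <= 1 -> -1 <= iter n smoothstep s <= 1.
Proof. by move=> h; elim: n => //= n; exact: smoothstep_itv. Qed.

Lemma iter_smoothstepN n s : iter n smoothstep (- s) = - iter n smoothstep s.
Proof. by elim: n => //= n ->; rewrite /smoothstep; field. Qed.

Lemma iter_smoothstep0 n : iter n smoothstep 0 = 0.
Proof. by elim: n => //= n ->; rewrite /smoothstep; field. Qed.

Lemma cvg_iter_smoothstep_gt0 s : 0 < s <= 1 -> (fun n => iter n smoothstep s) @ \oo --> (1 : R).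
Proof.
move=> /andP[s0 s1].
have pos n : 0 < iter n smoothstep s <= 1.
  elim: n => /= [|n /andP[i0 i1]]; first by rewrite s0.
  apply/andP; split; last first.
    have : -1 <= iter n smoothstep s <= 1 by rewrite i1 andbT; lra.
    by move=> /smoothstep_itv/andP[].
  rewrite /smoothstep divr_gt0// (_ : _ - _ = iter n smoothstep s * (3 - iter n smoothstep s ^+ 2)).
    by rewrite mulr_gt0//; nra.
  by ring.
have incr : nondecreasing_seq (fun n => iter n smoothstep s).
  apply/nondecreasing_seqP => n /=; have /andP[i0 i1] := pos n.
  rewrite -subr_ge0 /smoothstep; set i := iter n _ _ in i0 i1 *.
  rewrite (_ : _ - _ = i * (1 - i ^+ 2) / 2); last by field.
  by rewrite divr_ge0// mulr_ge0//; nra.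
have cv : cvgn (fun n => iter n smoothstep s).
  apply: nondecreasing_is_cvgn => //; exists 1 => _ [n _ <-].
  by case/andP: (pos n).
set l := limn (fun n => iter n smoothstep s).
have cl : (fun n => iter n smoothstep s) @ \oo --> l by [].
have l0 : 0 < l by apply: (lt_le_trans s0); exact: (nondecreasing_cvgn_le incr cv 0%N).
have c1 : (fun n => smoothstep (iter n smoothstep s)) @ \oo --> smoothstep l.
  rewrite /smoothstep; apply: cvgMl; apply: cvgB; first exact: cvgMr.
  exact: (continuous_cvg _ (@exprn_continuous R 3 l) cl).
have c2 : (fun n => iter n.+1 smoothstep s) @ \oo --> l by rewrite -cvg_shiftS in cl.
have e : smoothstep l = l by apply: (cvg_unique _ c1 c2).
have fac : l * ((1 - l) * (1 + l)) = 0 by move: e; rewrite /smoothstep => e; lra.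
move/eqP: fac; rewrite mulf_eq0 (gt_eqF l0) /= mulf_eq0 => /orP[/eqP l1|/eqP]; last by lra.
by rewrite (_ : 1 = l)//; lra.
Qed.

Lemma cvg_iter_smoothstep s : -1 <= s <= 1 ->
  (fun n => iter n smoothstep s) @ \oo --> Num.sg s.
Proof.
move=> /andP[s1 s2]; have [s0|s0|<-] := ltgtP 0 s.
- by rewrite gtr0_sg//; apply: cvg_iter_smoothstep_gt0; rewrite s0.
- rewrite ltr0_sg//.
  have -> : (fun n => iter n smoothstep s) = (fun n => - iter n smoothstep (- s)).
    by apply/funext => n; rewrite iter_smoothstepN opprK.
  by apply: cvgN; apply: cvg_iter_smoothstep_gt0; apply/andP; split; lra.
- rewrite sgr0; under eq_fun do rewrite iter_smoothstep0.
  exact: cvg_cst.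
Qed.

Lemma cvg_sg_sin s : (fun n => Num.sg (sin (s / n.+1%:R))) @ \oo --> Num.sg s.
Proof.
apply: cvg_near_cst; near=> n.
have n0 : 0 < n.+1%:R :> R by [].
have small : `|s| / n.+1%:R < pi.
  rewrite ltr_pdivrMr// mulrC -ltr_pdivrMr ?pi_gt0//.
  apply: (@lt_trans _ _ n%:R); last by rewrite ltr_nat.
  near: n; exact: nbhs_infty_gtr.
have [s0|s0|<-] := ltgtP 0 s.
- rewrite (gtr0_sg s0) gtr0_sg//; apply: sin_gt0_pi.
  by rewrite divr_gt0//= -(gtr0_norm s0).
- rewrite (ltr0_sg s0) ltr0_sg// -oppr_gt0 -sinN -mulNr; apply: sin_gt0_pi.
  by rewrite divr_gt0 ?oppr_gt0//= -(ltr0_norm s0).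
- by rewrite mul0r sin0.
Unshelve. all: by end_near. Qed.

End sign_iteration.

Section trig_sets.
Context (R : realType) (D : set R).
Local Notation C := (trig_class D).

(** A polynomial iteration stays in the class and converges to the sign. *)
Lemma trig_sg F : C F -> (forall x, -1 <= F x <= 1) -> C (fun x => Num.sg (F x)).
Proof.
move=> cF hF; apply: (@trig_lim _ D (fun n x => iter n (@smoothstep R) (F x)) 1).
- elim=> //= n cn; rewrite /smoothstep.
  have := trig_lin (3 / 2) cn (trigZ (- 2^-1) (trigM cn (trigM cn cn))).
  by congr C; apply/funext => x; rewrite !exprS expr0; field.
- by move=> n x; rewrite ler_norml; exact: iter_smoothstep_itv.
- by move=> x; exact: cvg_iter_smoothstep.
Qed.

(** The sign of sin ((x_t - y) / n) is that of x_t - y once n is large. *)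
Lemma trig_sg_coord t y : D t -> C (fun x => Num.sg (x t - y)).
Proof.
move=> Dt; apply: (@trig_lim _ D (fun n x => Num.sg (sin ((x t - y) / n.+1%:R))) 1).
- move=> n; apply: trig_sg => [|x]; last by rewrite -ler_norml sin_max.
  rewrite (_ : (fun x => _) =
      (fun x => sin (step_eval [:: (n.+1%:R^-1, t)] x + - y / n.+1%:R))).
    by apply: trig_sin => p; rewrite mem_seq1 => /eqP ->.
  by apply/funext => x; rewrite /step_eval big_seq1/= mulrBl mulrC mulNr.
- move=> n x; rewrite normr_sg; by case: (_ != _).
- by move=> x; exact: cvg_sg_sin.
Qed.

(** Products of indicators give finite intersections, and bounded limits the
    countable ones. *)
Lemma trig_class_sigma_algebra : sigma_algebra setT [set A | C \1_A].
Proof.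
have closedC A : C \1_A -> C \1_(~` A).
  move=> cA; have := trigB (trig_cst D 1) cA; congr C; apply/funext => x.
  by rewrite !indicE in_setC; case: (x \in A); rewrite ?subrr ?subr0.
split => /=.
- by rewrite indic0; exact: trig_cst.
- by move=> A /closedC; rewrite setTD.
move=> A cA; pose prodC n (x : R -> R) := \prod_(k < n) \1_(~` A k) x : R.
apply: (@trig_lim _ D (fun n x => 1 - prodC n x) 1).
- move=> n; apply: trigB; first exact: trig_cst.
  elim: n => [|n IH]; rewrite /prodC.
    by under eq_fun do rewrite big_ord0; exact: trig_cst.
  under eq_fun do rewrite big_ord_recr.
  by apply: trigM => //; exact: closedC.
- move=> n x.
  have p01 : 0 <= prodC n x <= 1.
    rewrite /prodC; elim/big_ind : _ => //; first by rewrite ler01 lexx.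
      by move=> a b /andP[? ?] /andP[? ?]; rewrite mulr_ge0//= mulr_ile1.
    by move=> i _; rewrite indicE; case: (_ \in _); rewrite ?lexx ?ler01.
  by rewrite ger0_norm; lra.
move=> x; apply: cvg_near_cst.
have [[k _ Ak]|nA] := pselect ((\bigcup_k A k) x).
  exists k.+1 => // n /= kn; rewrite indicE mem_set; last by exists k.
  rewrite /prodC (bigD1 (Ordinal kn))//= indicE memNset ?mul0r ?subr0//.
apply: nearW => n; rewrite indicE memNset// /prodC big1 ?subrr// => i _.
by rewrite indicE mem_set// => Ai; apply: nA; exists i.
Qed.

(** With s the sign of x_t - y, the indicator of x_t < y is (s^2 - s) / 2. *)
Lemma trig_indic A : generated_by D (fun t (x : R -> R) => x t) A -> C \1_A.
Proof.
apply: (generated_by_sub trig_class_sigma_algebra) => t y Dt /=.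
have cs := trig_sg_coord y Dt.
have := trigZ 2^-1 (trigB (trigM cs cs) cs); congr C; apply/funext => x.
rewrite indicE; have [xy|xy|xy] := ltgtP (x t) y.
- by rewrite mem_set//= ltr0_sg ?subr_lt0//; field.
- by rewrite memNset /= ?gtr0_sg ?subr_gt0 -?leNgt ?ltW//; last (by apply/negP; rewrite -leNgt ltW); field.
- by rewrite memNset /= xy ?subrr ?sgr0 ?ltxx//; ring.
Qed.

End trig_sets.

(** * Identities between trigonometric moments *)

Section bounded_factors.
Context (d : measure_display) (T : measurableType d) (R : realType)
  (mu : {measure set T -> \bar R}) (D : set T) (mD : measurable D).
Implicit Types f g W : T -> R.

Lemma integrable_mul_bounded W f M : mu.-integrable D (EFin \o W) ->
  measurable_fun D f -> (forall x, D x -> `|f x| <= M) ->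
  mu.-integrable D (fun x => (W x * f x)%:E).
Proof.
move=> iW mf fM; have := integrableZl mD M iW.
apply: le_integrable => //.
  apply/measurable_EFinP; apply: measurable_funM => //.
  by apply/measurable_EFinP; exact: measurable_int iW.
move=> x Dx /=; rewrite lee_fin !normrM mulrC ler_wpM2r//.
by rewrite (le_trans (fM _ Dx))// ler_norm.
Qed.

Lemma Rintegral_dominated_cvg (f_ : nat -> T -> R) f g :
  (forall n, measurable_fun D (f_ n)) -> measurable_fun D f ->
  (forall x, D x -> f_ ^~ x @ \oo --> f x) ->
  mu.-integrable D (EFin \o g) -> (forall n x, D x -> `|f_ n x| <= g x) ->
  (fun n => \int[mu]_(x in D) f_ n x) @ \oo --> \int[mu]_(x in D) f x.
Proof.
move=> mf_ mf cf ig fg.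
have [||||intf _ cvgf] := @dominated_convergence _ _ _ mu D mD
    (fun n x => (f_ n x)%:E) (EFin \o f) (EFin \o g) _ _ _ ig.
- by move=> n; exact/measurable_EFinP.
- exact/measurable_EFinP.
- apply: aeW => x Dx; apply: cvg_EFin; last exact: cf.
  exact: nearW.
- by apply: aeW => x n Dx; rewrite /= lee_fin fg.
apply: fine_cvg; rewrite fineK//; exact: integrable_fin_num.
Qed.

End bounded_factors.

Section paths.
Context (R : realType) (d : measure_display) (Omega : measurableType d)
  (P : probability Omega R).
Implicit Types (V : R -> {RV P >-> R}) (W : Omega -> R) (D : set R).

Definition sample_path V (w : Omega) : R -> R := fun t => V t w.

Definition at_time : R -> (R -> R) -> R := fun t x => x t.

Lemma generated_by_path D V S : generated_by D (fun t => V t : Omega -> R) S ->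
  exists2 A, generated_by D at_time A & S = sample_path V @^-1` A.
Proof.
move: S; apply: (@generated_by_sub _ _ _ _
  [set S | exists2 A, generated_by D at_time A & S = sample_path V @^-1` A]).
  have [c0 cC cU] := sigma_algebra_generated_by D at_time; split.
  - by exists set0; rewrite ?preimage_set0.
  - move=> _ [A cA ->]; exists (setT `\` A); first exact: cC.
    by rewrite !setTD preimage_setC.
  - move=> S_ hS; have /choice[A hA] : forall n, exists A,
        generated_by D at_time A /\ S_ n = sample_path V @^-1` A.
      by move=> n; have [A] := hS n; exists A.
    exists (\bigcup_n A n); first by apply: cU => n; case: (hA n).
    by rewrite preimage_bigcup; apply: eq_bigcupr => n _; case: (hA n).
move=> t y Dt; exists [set x | x t < y] => //.
have := @generated_by_preimage _ _ D at_time t `]-oo, y[ Dt (measurable_itv _).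
by congr generated_by; apply/seteqP; split => x; rewrite /= in_itv.
Qed.

Lemma measurable_path D V A : generated_by D at_time A ->
  measurable (sample_path V @^-1` A).
Proof.
move: A; apply: (@generated_by_sub _ _ _ _ [set A | measurable (sample_path V @^-1` A)]).
  split => /=.
  - by rewrite preimage_set0.
  - by move=> A mA; rewrite setTD preimage_setC; exact: measurableC.
  - by move=> A mA; rewrite preimage_bigcup; exact: bigcupT_measurable.
move=> t y _ /=; have := measurable_funP (V t) measurableT _ (measurable_itv `]-oo, y[).
by rewrite setTI; congr measurable; apply/seteqP; split => x; rewrite /= in_itv.
Qed.

Lemma measurable_trig D V F : trig_class D F ->
  measurable_fun setT (fun w => F (sample_path V w)).
Proof.
elim=> {F} [g th _|a F G _ mF _ mG|F_ M F _ mF _ cF].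
- have mcos : measurable_fun setT (@cos R).
    by apply: continuous_measurable_fun => x; exact: continuous_cos.
  apply: (measurableT_comp mcos).
  apply: measurable_funD => //; apply: measurable_sum => p; apply: measurable_funM => //; exact: (measurable_funP (V p.2)).
- by apply: measurable_funD => //; exact: measurable_funM.
- by apply: measurable_fun_cvg mF _ => x _; exact: cF.
Qed.

Context (D : set R) (V1 V2 : R -> {RV P >-> R}) (W1 W2 : Omega -> R).
Hypotheses (iW1 : P.-integrable setT (EFin \o W1))
  (iW2 : P.-integrable setT (EFin \o W2)).

(** Both sides are linear and continuous under bounded convergence in F. *)
Lemma trig_class_determined :
  (forall g th, (forall p, p \in g -> D p.2) ->
    \int[P]_w (W1 w * cos (step_eval g (sample_path V1 w) + th)) =
    \int[P]_w (W2 w * cos (step_eval g (sample_path V2 w) + th))) ->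
  forall F, trig_class D F ->
    \int[P]_w (W1 w * F (sample_path V1 w)) = \int[P]_w (W2 w * F (sample_path V2 w)).
Proof.
move=> h F; elim=> {F} [g th hg|a F G cF hF cG hG|F_ M F cF hF bF cvF].
- exact: h.
- have iWF V W K : P.-integrable setT (EFin \o W) -> trig_class D K ->
      P.-integrable setT (fun x => (W x * K (sample_path V x))%:E).
    move=> iW cK; have [M hM] := trig_bounded cK.
    by apply: (integrable_mul_bounded measurableT iW (measurable_trig V cK)).
  have e W V : P.-integrable setT (EFin \o W) ->
      \int[P]_w (W w * (a * F (sample_path V w) + G (sample_path V w))) =
      a * \int[P]_w (W w * F (sample_path V w)) + \int[P]_w (W w * G (sample_path V w)).
    move=> iW; rewrite -RintegralZl//; last exact: iWF.
    rewrite -RintegralD//; last 2 first.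
    + exact: (integrableZl measurableT a (iWF V _ _ iW cF)).
    + exact: iWF.
    by apply: eq_Rintegral => w _; rewrite mulrDr mulrCA.
  by rewrite !e// hF hG.
have cvW W V : P.-integrable setT (EFin \o W) ->
    (fun n => \int[P]_w (W w * F_ n (sample_path V w))) @ \oo --> \int[P]_w (W w * F (sample_path V w)).
  move=> iW; have mW : measurable_fun setT W.
    by apply/measurable_EFinP; exact: measurable_int iW.
  apply: (@Rintegral_dominated_cvg _ _ _ _ _ _ _ _ (fun w => M * `|W w|)) => //.
  - by move=> n; apply: measurable_funM => //; exact: measurable_trig.
  - by apply: measurable_funM => //; apply: (measurable_trig V); exact: trig_lim cF bF cvF.
  - by move=> w _; apply: cvgMr.
  - apply: (integrableZl measurableT M (f := fun w => `|W w|%:E)).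
    exact: (integrable_abse iW).
  - by move=> n w _; rewrite normrM mulrC ler_wpM2r.
have := cvW W1 V1 iW1; under [X in X @ _]eq_fun do rewrite hF.
by move=> /cvg_unique; apply => //; exact: cvW.
Qed.

End paths.

(** * Transfer of laws to adapted functionals *)

Section transfer.
Context (R : realType) (d : measure_display) (Omega : measurableType d)
  (P : probability Omega R).
Implicit Types (V W : R -> {RV P >-> R}) (D : set R).
Local Notation nonneg := (`[(0 : R), +oo[%classic : set R).

Lemma integrable_indic_path D V (A : set (R -> R)) : generated_by D (@at_time R) A ->
  P.-integrable setT (fun w => (\1_A (sample_path V w))%:E).
Proof.
move=> cA; exact: (integrable_indic P (measurable_path V cA)).
Qed.

Lemma generated_by_setD (T : Type) D (X : R -> T -> R) A B :
  generated_by D X A -> generated_by D X B -> generated_by D X (A `\` B).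
Proof.
have [c0 cC cU] := sigma_algebra_generated_by D X.
move=> hA hB; rewrite (_ : A `\` B = setT `\` (\bigcup_i (bigcup2 (setT `\` A) B i))).
  by apply: (cC); apply: cU; case=> [|[|n]] //=; exact: cC.
by rewrite bigcup2E !setTD setCU setCK setDE.
Qed.

Lemma ae_le_measure (A B : set Omega) : measurable A -> measurable B ->
  {ae P, forall w, A w -> B w} -> (P A <= P B)%E.
Proof.
move=> mA mB [N [mN N0 hN]]; apply: (@le_trans _ _ (P (B `|` N))).
  apply: le_measure; rewrite ?inE//; first exact: measurableU.
  move=> w Aw; have [Bw|nB] := pselect (B w); [by left|right].
  by apply: hN => /= /(_ Aw).
by apply: (le_trans (measureU2 _ _ _)) => //; have := N0; rewrite /= => ->; rewrite adde0.
Qed.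

Lemma same_law_trig V1 V2 :
  (forall g th, (forall p, p \in g -> nonneg p.2) ->
    \int[P]_w cos (step_eval g (sample_path V1 w) + th) =
    \int[P]_w cos (step_eval g (sample_path V2 w) + th)) ->
  forall F, trig_class nonneg F ->
    \int[P]_w F (sample_path V1 w) = \int[P]_w F (sample_path V2 w).
Proof.
move=> h F cF.
have i1 : P.-integrable setT (EFin \o (fun=> 1 : R)).
  exact: finite_measure_integrable_cst.
have := @trig_class_determined _ _ _ P nonneg V1 V2 (fun=> 1) (fun=> 1) i1 i1 _ F cF.
under eq_Rintegral do rewrite mul1r.
under [X in _ = X]eq_Rintegral do rewrite mul1r.
apply=> g th hg; under eq_Rintegral do rewrite mul1r.
by under [RHS]eq_Rintegral do rewrite mul1r; exact: h.
Qed.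

Lemma Rintegral_indic (A : set Omega) : measurable A -> \int[P]_w (\1_A w) = fine (P A).
Proof. by move=> mA; rewrite /Rintegral integral_indic// setIT. Qed.

Section two_processes.
Variables (V1 V2 : R -> {RV P >-> R}).
Hypothesis sameV : forall F, trig_class nonneg F ->
    \int[P]_w F (sample_path V1 w) = \int[P]_w F (sample_path V2 w).

Lemma same_law_paths A : generated_by nonneg (@at_time R) A ->
  P (sample_path V1 @^-1` A) = P (sample_path V2 @^-1` A).
Proof.
move=> cA; have fin V : P (sample_path V @^-1` A) \is a fin_num by exact: fin_num_measure (measurable_path _ cA).
have := sameV (trig_indic cA).
move=> e; rewrite -(fineK (fin V1)) -(fineK (fin V2)); congr EFin.
by rewrite -!Rintegral_indic//; exact: measurable_path cA.
Qed.

(** If the two functionals ever differed on S, where the first one is below y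
    and the second one is not, then y - W would integrate over S to something
    positive on one side and nonpositive on the other. *)
Lemma halfline_events_agree D (W1 W2 : {RV P >-> R}) y A1 A2 : D `<=` nonneg ->
  P.-integrable setT (EFin \o W1) -> P.-integrable setT (EFin \o W2) ->
  (forall F, trig_class D F ->
    \int[P]_w (W1 w * F (sample_path V1 w)) = \int[P]_w (W2 w * F (sample_path V2 w))) ->
  generated_by D (@at_time R) A1 -> generated_by D (@at_time R) A2 ->
  [set w | W1 w < y] = sample_path V1 @^-1` A1 -> [set w | W2 w < y] = sample_path V2 @^-1` A2 ->
  P (sample_path V1 @^-1` (A1 `\` A2)) = 0%E.
Proof.
move=> D0 i1 i2 sW c1 c2 e1 e2; set S := A1 `\` A2.
have cS : generated_by D (@at_time R) S.
  by apply: generated_by_setD.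
pose G (W : {RV P >-> R}) V w := (y - W w) * \1_S (sample_path V w).
have mS V := measurable_path V cS.
have mind V : measurable_fun setT (fun w => \1_S (sample_path V w) : R).
  by have := @measurable_indic _ _ R setT _ (mS V).
have iWS (W : {RV P >-> R}) V : P.-integrable setT (EFin \o W) ->
    P.-integrable setT (fun x => (W x * \1_S (sample_path V x))%:E).
  move=> iW; apply: (@integrable_mul_bounded _ _ _ P setT measurableT W _ 1 iW) => // x _.
  by rewrite indicE; case: (_ \in _); rewrite ?normr1 ?normr0.
have GE (W : {RV P >-> R}) V : P.-integrable setT (EFin \o W) ->
    \int[P]_w G W V w = y * \int[P]_w \1_S (sample_path V w) - \int[P]_w (W w * \1_S (sample_path V w)).
  move=> iW; rewrite -RintegralZl//; last exact: integrable_indic_path cS.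
  rewrite -RintegralB//; last 2 first.
  - exact: (integrableZl measurableT y (integrable_indic_path V cS)).
  - exact: iWS.
  by apply: eq_Rintegral => w _; rewrite /G mulrBl.
have eG : \int[P]_w G W1 V1 w = \int[P]_w G W2 V2 w.
  rewrite !GE// sW; last exact: trig_indic.
  by rewrite sameV//; apply: trig_indic; exact: generated_by_mono cS.
have pos w : 0 <= G W1 V1 w.
  rewrite /G indicE; have [/set_mem [Aw _]|_] := boolP (_ \in S); last by rewrite mulr0.
  rewrite mulr1 subr_ge0 ltW//.
  by have : (sample_path V1 @^-1` A1) w by []; rewrite -e1.
have neg w : G W2 V2 w <= 0.
  rewrite /G indicE; have [/set_mem [_ Aw]|_] := boolP (_ \in S); last by rewrite mulr0.
  rewrite mulr1 subr_le0 leNgt; apply/negP => Wy; apply: Aw.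
  by have : [set w | W2 w < y] w by []; rewrite e2.
have iG1 : P.-integrable setT (EFin \o G W1 V1).
  have := integrableB measurableT (integrableZl measurableT y (integrable_indic_path V1 cS))
    (iWS W1 V1 i1).
  apply: eq_integrable => // w _ /=; by rewrite /G mulrBl EFinB EFinM.
have G0 : \int[P]_w G W1 V1 w = 0.
  apply/eqP; rewrite eq_le Rintegral_ge0// andbT eG -oppr_ge0.
  rewrite -mulN1r -RintegralZl//; first by apply: Rintegral_ge0 => w _; have := neg w; lra.
  have := integrableB measurableT (integrableZl measurableT y (integrable_indic_path V2 cS))
    (iWS W2 V2 i2).
  by apply: eq_integrable => // w _ /=; rewrite /G mulrBl EFinB EFinM.
have : (\int[P]_w (`|(EFin \o G W1 V1) w|) = 0)%E.
  under eq_integral do rewrite gee0_abs ?lee_fin//.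
  rewrite -[LHS]fineK; first by rewrite -[fine _]/(\int[P]_w G W1 V1 w) G0.
  exact: integrable_fin_num iG1.
move/(ae_eq_integral_abs P measurableT (measurable_int _ iG1)) => aeG.
apply: measure_negligible => //; apply: negligibleS aeG => w Sw /=.
move=> /(_ I) [] /eqP; apply/negP.
rewrite /G indicE mem_set// mulr1 subr_eq0 gt_eqF//.
case: Sw => Aw _.
by have : (sample_path V1 @^-1` A1) w by []; rewrite -e1.
Qed.

End two_processes.

(** The cylinder events that W1 and W2 realize, up to null sets, as one and the
    same event of the paths of V1 and V2 form a sigma-algebra. *)
Lemma same_law_functionals V1 V2 W1 W2 :
  (forall g th, (forall p, p \in g -> nonneg p.2) ->
    \int[P]_w cos (step_eval g (sample_path V1 w) + th) =
    \int[P]_w cos (step_eval g (sample_path V2 w) + th)) ->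
  (forall t, 0 < t -> P.-integrable setT (EFin \o W1 t)) ->
  (forall t, 0 < t -> P.-integrable setT (EFin \o W2 t)) ->
  (forall t, 0 < t -> preimage_set_system setT (W1 t) measurable `<=` sigma_field_upto V1 t) ->
  (forall t, 0 < t -> preimage_set_system setT (W2 t) measurable `<=` sigma_field_upto V2 t) ->
  (forall t g th, 0 < t -> (forall p, p \in g -> 0 <= p.2 <= t) ->
    \int[P]_w (W1 t w * cos (step_eval g (sample_path V1 w) + th)) =
    \int[P]_w (W2 t w * cos (step_eval g (sample_path V2 w) + th))) ->
  {ae P, forall w, W1 0 w = 0} -> {ae P, forall w, W2 0 w = 0} ->
  same_law P (fun t w => W1 t w) (fun t w => W2 t w).
Proof.
move=> hV i1 i2 m1 m2 hW z1 z2.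
have sV := same_law_trig hV.
have sV' : forall F, trig_class nonneg F ->
    \int[P]_w F (sample_path V2 w) = \int[P]_w F (sample_path V1 w) by move=> F /sV ->.
pose good (A : set (R -> R)) := exists2 C, generated_by nonneg (@at_time R) C &
  {ae P, forall w, A (sample_path W1 w) <-> C (sample_path V1 w)} /\
  {ae P, forall w, A (sample_path W2 w) <-> C (sample_path V2 w)}.
have sgood : sigma_algebra setT good.
  have [c0 cC cU] := @sigma_algebra_generated_by _ _ nonneg (@at_time R); split.
  - by exists set0 => //; split; apply: aeW.
  - move=> A [C cA [h1 h2]]; exists (setT `\` C); first exact: cC.
    by split; [move: h1|move: h2]; apply: filterS => w [h h'];
      split => -[_ nA]; split => // ?; apply: nA; tauto.
  - move=> A hA; have /choice[C hC] : forall n, exists C,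
        [/\ generated_by nonneg (@at_time R) C,
        {ae P, forall w, A n (sample_path W1 w) <-> C (sample_path V1 w)} &
        {ae P, forall w, A n (sample_path W2 w) <-> C (sample_path V2 w)}].
      by move=> n; have [C ? [? ?]] := hA n; exists C.
    exists (\bigcup_n C n); first by apply: cU => n; case: (hC n).
    split.
      have : forall n, {ae P, forall w, A n (sample_path W1 w) <-> C n (sample_path V1 w)}.
        by move=> n; case: (hC n).
      move/ae_foralln; apply: filterS => w h.
      by split => -[n _ /h ?]; exists n.
    have : forall n, {ae P, forall w, A n (sample_path W2 w) <-> C n (sample_path V2 w)}.
      by move=> n; case: (hC n).
    move/ae_foralln; apply: filterS => w h.
    by split => -[n _ /h ?]; exists n.
have goodE : forall A, cylinder_sigma A -> good A.
  apply: (generated_by_sub sgood) => t y /=; rewrite in_itv/= andbT le_eqVlt.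
  move=> /predU1P[<-|t0].
    (* at time 0 both functionals vanish, so the event is sure or impossible *)
    have [y0|y0] := boolP (0 < y).
      exists setT; first by case: (@sigma_algebra_generated_by _ _ nonneg (@at_time R)) => c0 /(_ _ c0); rewrite setD0.
      by split; [move: z1|move: z2]; apply: filterS => w; rewrite /= /sample_path => ->.
    exists set0; first by case: (@sigma_algebra_generated_by _ _ nonneg (@at_time R)).
    by split; [move: z1|move: z2]; apply: filterS => w; rewrite /= /sample_path => ->; split => //; rewrite (negbTE y0).
  pose D := [set s : R | 0 <= s <= t].
  have DE : D = `[0, t]%classic by apply/seteqP; split => s; rewrite /= in_itv.
  have D0 : D `<=` nonneg by move=> s /andP[s0 _]; rewrite /= in_itv/= s0.
  have ev (W V : R -> {RV P >-> R}) : preimage_set_system setT (W t) measurable `<=` sigma_field_upto V t ->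
      exists2 A, generated_by D (@at_time R) A & [set w | W t w < y] = sample_path V @^-1` A.
    move=> mW; apply: generated_by_path; rewrite DE; apply: mW.
    exists `]-oo, y[%classic; first exact: measurable_itv.
    by rewrite setTI; apply/seteqP; split => x; rewrite /= in_itv.
  have [A1 cA1 e1] := ev W1 V1 (m1 t t0).
  have [A2 cA2 e2] := ev W2 V2 (m2 t t0).
  have sW : forall F, trig_class D F ->
    \int[P]_w (W1 t w * F (sample_path V1 w)) = \int[P]_w (W2 t w * F (sample_path V2 w)).
    by apply: trig_class_determined; [exact: i1|exact: i2|move=> g th hg; exact: hW].
  have n12 := halfline_events_agree sV D0 (i1 t t0) (i2 t t0) sW cA1 cA2 e1 e2.
  have n21 := halfline_events_agree sV' D0 (i2 t t0) (i1 t t0)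
    (fun F cF => esym (sW F cF)) cA2 cA1 e2 e1.
  have n12' : P (sample_path V2 @^-1` (A1 `\` A2)) = 0%E.
    by rewrite -(same_law_paths sV)//; apply: (generated_by_mono D0); exact: generated_by_setD.
  exists A1; first exact: generated_by_mono cA1.
  split.
    apply: aeW => w; rewrite -[A1 _]/((sample_path V1 @^-1` A1) w) -e1 //.
  have ng A : P A = 0%E -> measurable A -> P.-negligible A by move=> PA mA; apply/negligibleP.
  have := negligibleU (ng _ n12' (measurable_path V2 (generated_by_setD cA1 cA2)))
    (ng _ n21 (measurable_path V2 (generated_by_setD cA2 cA1))).
  apply: negligibleS => w /= nh.
  have e : ([set w | W2 t w < y] w) = ((sample_path V2 @^-1` A2) w) by rewrite e2.
  have [a1|a1] := pselect (A1 (sample_path V2 w)); have [a2|a2] := pselect (A2 (sample_path V2 w)).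
  - by exfalso; apply: nh; split => // _; move: a2; rewrite -[A2 _]/((sample_path V2 @^-1` A2) w) -e.
  - by left.
  - by right.
  - exfalso; apply: nh; split => // h; exfalso; apply: a2.
    by rewrite -[A2 _]/((sample_path V2 @^-1` A2) w) -e.
move=> A cA; have [C cC [h1 h2]] := goodE A cA.
rewrite (_ : [set w | _] = sample_path W1 @^-1` A)// (_ : [set w | A (fun t => W2 t w)] = sample_path W2 @^-1` A)//.
have eqm V W : {ae P, forall w, A (sample_path W w) <-> C (sample_path V w)} ->
    P (sample_path W @^-1` A) = P (sample_path V @^-1` C).
  move=> h; have mW := measurable_path W cA; have mV := measurable_path V cC.
  by apply/eqP; rewrite eq_le !ae_le_measure//; move: h; apply: filterS => w [].
by rewrite (eqm V1 W1 h1) (eqm V2 W2 h2); exact: (same_law_paths sV cC).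
Qed.

End transfer.

(** * Affine changes of variables and Gaussian laws *)

Section affine_change_of_variables.
Context (R : realType).
Local Notation mu := (@lebesgue_measure R).
Implicit Types a b : R.

Let aff a b : measurableTypeR R -> measurableTypeR R := fun x => a * (x : R) + b.

Let maff a b : measurable_fun setT (aff a b).
Proof. by apply: measurable_funD => //; exact: measurable_funM. Qed.

(** Both sides are measures with the same values on intervals. *)
Lemma lebesgue_measure_affine a b : 0 < a -> forall A : set R, measurable A ->
  mu A = (a%:E * pushforward mu (aff a b) A)%E.
Proof.
move=> a0 A mA; have a0' : 0 <= a by exact: ltW.
have [pm pmE] : exists pm : {measure set (measurableTypeR R) -> \bar R},
    pm = pushforward mu (aff a b) :> (set _ -> \bar R).
  by unshelve (eexists; reflexivity); exact: maff.
pose m := mscale (NngNum a0') pm.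
have mE B : m B = (a%:E * pushforward mu (aff a b) B)%E by rewrite -pmE.
rewrite -mE; apply: lebesgue_measure_unique => // _ [[x y] /= _ <-].
apply: etrans (esym (mE _)); rewrite /pushforward.
have -> : aff a b @^-1` `]x, y] = `](x - b) / a, (y - b) / a]%classic.
  apply/seteqP; split => z /=; rewrite !in_itv/= ltr_pdivrMr// ler_pdivlMr// /aff;
    by rewrite ltrBlDr lerBrDr (mulrC z).
rewrite !lebesgue_measure_itv/= !lte_fin ltr_pM2r ?invr_gt0// ltrD2r.
case: ifPn => _; last by rewrite mule0.
by rewrite -!EFinD -EFinM; congr EFin; field; rewrite gt_eqF.
Qed.

Lemma ge0_integral_affine a b (f : R -> \bar R) : 0 < a ->
  measurable_fun setT f -> (forall x, 0 <= f x)%E ->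
  (\int[mu]_x f x = a%:E * \int[mu]_x f (a * x + b)%R)%E.
Proof.
move=> a0 mf f0; have a0' : 0 <= a by exact: ltW.
have h := @ge0_integral_pushforward _ _ _ _ R (aff a b) (maff a b) mu setT f
  measurableT mf (fun x _ => f0 x).
rewrite preimage_setT in h.
rewrite -[X in (_ * X)%E]/(\int[mu]_x (f \o aff a b) x)%E -h.
have [pm pmE] : exists pm : {measure set (measurableTypeR R) -> \bar R},
    pm = pushforward mu (aff a b) :> (set _ -> \bar R).
  by unshelve (eexists; reflexivity); exact: maff.
rewrite -pmE -[RHS](ge0_integral_mscale pm measurableT (NngNum a0'))//.
by apply: eq_measure_integral => A mA _; 
  transitivity (a%:E * pm A)%E => //; rewrite pmE; exact: lebesgue_measure_affine.
Qed.

End affine_change_of_variables.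

Section gaussian_laws.
Context (R : realType).
Local Notation mu := (@lebesgue_measure R).
Implicit Types (a b m s : R) (A : set R).

Lemma normal_pdf_affine a b m s x : 0 < a -> s != 0 ->
  a * normal_pdf (a * m + b) (a * s) (a * x + b) = normal_pdf m s x.
Proof.
move=> a0 s0; have an0 : a != 0 by rewrite gt_eqF.
rewrite !normal_pdfE ?mulf_neq0// /normal_peak /normal_fun.
have -> : (a * s) ^+ 2 * pi *+ 2 = a ^+ 2 * (s ^+ 2 * pi *+ 2).
  by rewrite exprMn -mulrA mulrnAr.
have -> : - (a * x + b - (a * m + b)) ^+ 2 / ((a * s) ^+ 2 *+ 2) =
    - (x - m) ^+ 2 / (s ^+ 2 *+ 2).
  by field; rewrite s0 an0.
by rewrite sqrtrM ?sqr_ge0// sqrtr_sqr gtr0_norm// invfM !mulrA divff// mul1r.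
Qed.

Lemma normal_prob_affine a b m s A : 0 < a -> s != 0 -> measurable A ->
  normal_prob (a * m + b) (a * s) A = normal_prob m s [set x | A (a * x + b)].
Proof.
move=> a0 s0 mA; rewrite /normal_prob integral_mkcond.
rewrite (@ge0_integral_affine _ a b)//; last 2 first.
- apply/(measurable_restrictT _ mA)/measurable_funTS/measurable_EFinP.
  exact: measurable_normal_pdf.
- by move=> x; rewrite patchE; case: ifP => // _; rewrite lee_fin normal_pdf_ge0.
rewrite -ge0_integralZl//; last 3 first.
- apply: (measurableT_comp (f := (fun x => (normal_pdf (a * m + b) (a * s) x)%:E) \_ A)).
    apply/(measurable_restrictT _ mA)/measurable_funTS/measurable_EFinP.
    exact: measurable_normal_pdf.
  by apply: measurable_funD => //; exact: measurable_funM.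
- by move=> x _; rewrite patchE; case: ifP => // _; rewrite lee_fin normal_pdf_ge0.
- by rewrite lee_fin ltW.
rewrite [RHS]integral_mkcond; apply: eq_integral => x _.
rewrite !patchE; have [xA|xA] := boolP (a * x + b \in A).
  rewrite mem_set; last exact: set_mem.
  by rewrite -EFinM normal_pdf_affine.
by rewrite memNset ?mule0// => /= h; move: xA; rewrite mem_set.
Qed.

Context (d : measure_display) (Omega : measurableType d) (P : probability Omega R).
Implicit Types V W : {RV P >-> R}.
Local Notation sq := (sqint P setT).
Local Notation N2 f := (ip P setT f f).

Lemma Rintegral_const b : \int[P]_w b = b.
Proof.
rewrite Rintegral_cst//.
by rewrite (_ : fine _ = 1) ?mulr1//; have := probability_setT P; move=> /= ->.
Qed.

Definition same_distribution V W := forall A : set R, measurable A ->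
  P (V @^-1` A) = P (W @^-1` A).

Lemma same_distribution_integral V W (f : R -> R) : same_distribution V W ->
  measurable_fun setT f -> P.-integrable setT (EFin \o (f \o V)) ->
  P.-integrable setT (EFin \o (f \o W)) ->
  \int[P]_w f (V w) = \int[P]_w f (W w).
Proof.
move=> VW mf iV iW; congr fine.
have mf' : measurable_fun setT (EFin \o f) by exact/measurable_EFinP.
have := @integral_distribution _ _ _ _ _ P V _ mf' iV; rewrite /= => <-.
have := @integral_distribution _ _ _ _ _ P W _ mf' iW; rewrite /= => <-.
by apply: eq_measure_integral => A mA _; exact: VW.
Qed.

Lemma same_distribution_cos V W th : same_distribution V W ->
  \int[P]_w cos (V w + th) = \int[P]_w cos (W w + th).
Proof.
move=> VW; have mc : measurable_fun setT (fun x : R => cos (x + th)).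
  apply: continuous_measurable_fun => x.
  by apply: continuous_comp; [apply: cvgD => //; exact: cvg_cst|exact: continuous_cos].
have ic (Z : {RV P >-> R}) : P.-integrable setT (EFin \o ((fun x => cos (x + th)) \o Z)).
  have i1 : P.-integrable setT (EFin \o (fun=> 1 : R)).
    exact: finite_measure_integrable_cst.
  apply: le_integrable i1 => //; first by apply/measurable_EFinP; exact: measurableT_comp.
  by move=> x _ /=; rewrite lee_fin normr1 cos_max.
exact: (same_distribution_integral VW mc).
Qed.

Lemma same_distribution_zero V W : sq V -> sq W -> N2 V = 0 -> N2 W = 0 ->
  same_distribution V W.
Proof.
have ae0 (Z : {RV P >-> R}) : sq Z -> N2 Z = 0 -> {ae P, forall w, Z w = 0}.
  move=> sZ Z0.
  have : (\int[P]_w `|(Z w ^+ 2)%:E| = 0)%E.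
    under eq_integral do rewrite gee0_abs ?lee_fin ?sqr_ge0//.
    by rewrite ip_integral// Z0.
  move/(ae_eq_integral_abs P measurableT (measurable_int _ (sqint_integrable sZ))).
  by apply: filterS => w /(_ I) [/eqP]; rewrite sqrf_eq0 => /eqP.
move=> sV sW V0 W0 A mA.
have mZ (Z : {RV P >-> R}) : measurable (Z @^-1` A).
  by rewrite -[X in measurable X]setTI; exact: (measurable_funP Z).
apply/eqP; rewrite eq_le !ae_le_measure//;
  by move: (ae0 _ sV V0) (ae0 _ sW W0); apply: filterS2 => w /= -> ->.
Qed.

(** A nondegenerate normal law is the image of any other nondegenerate one by an
    affine map of positive slope, and such a map preserves the mean 0 and the variance only
    if it is the identity. *)
Lemma centered_gaussian_law V W : gaussian_rv P V -> gaussian_rv P W ->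
  sq V -> sq W -> \int[P]_w V w = 0 -> \int[P]_w W w = 0 -> N2 V = N2 W ->
  same_distribution V W.
Proof.
have i1 : P.-integrable setT (EFin \o (fun=> 1 : R)).
  exact: finite_measure_integrable_cst.
have sq1 : sq (fun=> 1).
  by apply: integrable_sqint => //; under eq_fun do rewrite expr1n.
have int1 (Z : Omega -> R) : sq Z -> P.-integrable setT (EFin \o Z).
  move=> sZ; have := sqint_mul measurableT sZ sq1.
  by under eq_fun do rewrite mulr1.
have E1 := Rintegral_const 1.
have pos (Z : {RV P >-> R}) m s : sq Z -> \int[P]_w Z w = 0 -> N2 Z != 0 -> 0 <= s ->
    (forall A : set R, measurable A ->
      P (Z @^-1` A) = if s == 0 then \d_m A else normal_prob m s A) -> 0 < s.
  move=> sZ Z0 nZ s0 h; rewrite lt_neqAle s0 andbT eq_sym; apply/negP => /eqP es.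
  have aeZ : {ae P, forall w, Z w = m}.
    exists (Z @^-1` (~` [set m])); split.
    - by rewrite -[X in measurable X]setTI; apply: (measurable_funP Z) => //; exact: measurableC.
    - by rewrite h ?es ?eqxx; [rewrite diracE memNset//= => /(_ erefl)|exact: measurableC].
    - by [].
  have cm : \int[P]_w Z w = m.
    rewrite -[RHS]mulr1 -E1 -RintegralZl//; congr fine; apply: ae_eq_integral => //.
    + exact: measurable_int (int1 _ sZ).
    + by move: aeZ; apply: filterS => w -> _; rewrite mulr1.
  case/negP: nZ; rewrite /ip; apply/eqP.
  have -> : 0 = \int[P]_w (0 : R) by rewrite Rintegral_const.
  congr fine; apply: ae_eq_integral => //.
  - exact: measurable_int (sqint_mul measurableT sZ sZ).
  - by move: aeZ; apply: filterS => w -> _; rewrite -cm Z0 mulr0.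
move=> [m [s [s0 hV]]] [m' [s' [s0' hW]]] sV sW V0 W0 eVW.
have [N0|nV] := eqVneq (N2 V) 0; first by apply: same_distribution_zero; rewrite -?eVW.
have sp := pos _ _ _ sV V0 nV s0 hV.
have sp' : 0 < s' by apply: (pos _ _ _ sW W0 _ s0' hW); rewrite -eVW.
pose a := s' / s; pose b := m' - a * m.
have a0 : 0 < a by rewrite divr_gt0.
have mU : measurable_fun setT (fun w => a * V w + b).
  by apply: measurable_funD => //; exact: measurable_funM.
pose mixU := isMeasurableFun.Build _ _ _ _ _ mU.
pose U : {RV P >-> R} := HB.pack (fun w => a * V w + b) mixU.
have UW : same_distribution U W.
  move=> A mA; rewrite hW// gt_eqF//.
  have -> : m' = a * m + b by rewrite /b addrC subrK.
  have -> : s' = a * s by rewrite /a divfK// gt_eqF.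
  rewrite normal_prob_affine ?gt_eqF//.
  have := hV [set x | A (a * x + b)]; rewrite gt_eqF//; apply.
  rewrite -[X in measurable X]setTI.
  have : measurable_fun setT (fun x : R => a * x + b).
    by apply: measurable_funD => //; exact: measurable_funM.
  by apply.
have sU : sq U.
  apply: sqintD => //; first exact: sqintZ.
  by have := sqintZ measurableT b sq1; under eq_fun do rewrite mulr1.
have b0 : b = 0.
  have : \int[P]_w U w = \int[P]_w W w.
    by apply: (same_distribution_integral (f := id) UW) => //; exact: int1.
  rewrite W0 RintegralD//; last 2 first.
  - exact: (integrableZl measurableT a (int1 _ sV)).
  - exact: finite_measure_integrable_cst.
  rewrite RintegralZl//; last exact: int1.
  by rewrite V0 mulr0 add0r Rintegral_const.
have a1 : a = 1.
  have : N2 U = N2 W.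
    apply: (same_distribution_integral (f := fun x => x * x) UW) => //.
    - exact: measurable_funM.
    - exact: sqint_mul.
    - exact: sqint_mul.
  have -> : (U : Omega -> R) = (fun w => a * V w).
    by apply/funext => w; rewrite /U /= b0 addr0.
  rewrite ipZl//; last exact: sqintZ.
  rewrite ipC ipZl// -eVW => /eqP; rewrite mulrA -subr_eq0 -[X in _ - X]mul1r -mulrBl.
  rewrite mulf_eq0 (negbTE nV) orbF => /eqP ?; nra.
by move=> A mA; rewrite -UW//; congr (P _); apply/seteqP; split => w;
  rewrite /= a1 b0 mul1r addr0.
Qed.

End gaussian_laws.

(** * The norm of increments *)

Section L2norm.
Context (d : measure_display) (T : measurableType d) (R : realType)
  (mu : {measure set T -> \bar R}) (D : set T) (mD : measurable D).
Implicit Types f g : T -> R.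
Local Notation sq := (sqint mu D).

Definition L2norm f : R := Num.sqrt (ip mu D f f).

Lemma L2norm_ge0 f : 0 <= L2norm f. Proof. exact: sqrtr_ge0. Qed.

Lemma L2norm_sqr f : L2norm f ^+ 2 = ip mu D f f.
Proof. by rewrite sqr_sqrtr// ip_ge0. Qed.

Lemma ip_le_norm f g : sq f -> sq g -> `|ip mu D f g| <= L2norm f * L2norm g.
Proof.
move=> hf hg; rewrite -sqrtrM ?ip_ge0// -sqrtr_sqr ler_wsqrtr//.
exact: ip_CauchySchwarz.
Qed.

Lemma L2normD f g : sq f -> sq g -> L2norm (fun x => f x + g x) <= L2norm f + L2norm g.
Proof.
move=> hf hg; have hfg := sqintD mD hf hg.
rewrite -(@ler_pXn2r _ 2)// ?nnegrE ?addr_ge0 ?L2norm_ge0//.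
rewrite L2norm_sqr ipDl// !(ipC _ _ _ (fun x => f x + g x)) !ipDl// (ipC _ _ g f).
rewrite sqrrD !L2norm_sqr.
by have := le_trans (ler_norm _) (ip_le_norm hf hg); lra.
Qed.

Lemma L2normZ a f : sq f -> L2norm (fun x => a * f x) = `|a| * L2norm f.
Proof.
move=> hf; have hZ := sqintZ mD a hf.
rewrite /L2norm ipZl// ipC ipZl// mulrA -expr2 sqrtrM ?sqr_ge0//.
by rewrite sqrtr_sqr.
Qed.

Lemma L2norm0 : L2norm (fun=> 0) = 0.
Proof.
rewrite /L2norm /ip; under eq_Rintegral do rewrite mul0r.
by rewrite Rintegral_cst// mul0r sqrtr0.
Qed.

Lemma L2norm_sum (I : eqType) (s : seq I) (c : I -> R) (F : I -> T -> R) (M : R) :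
  (forall i, i \in s -> sq (F i)) -> (forall i, i \in s -> L2norm (F i) <= M) ->
  L2norm (fun x => \sum_(i <- s) c i * F i x) <= (\sum_(i <- s) `|c i|) * M.
Proof.
elim: s => [_ _|i s IH hs hM].
  under [X in L2norm X]eq_fun do rewrite big_nil.
  by rewrite big_nil mul0r L2norm0.
under [X in L2norm X]eq_fun do rewrite big_cons.
have sqs j : j \in i :: s -> sq (fun x => c j * F j x) by move=> js; apply: sqintZ => //; exact: hs.
apply: (le_trans (L2normD _ _)).
- by apply: sqs; rewrite mem_head.
- by apply: sqint_sum => // j js; apply: sqs; rewrite in_cons js orbT.
rewrite big_cons mulrDl lerD//.
  rewrite L2normZ; last by apply: hs; rewrite mem_head.
  by rewrite ler_wpM2l// hM// mem_head.
by apply: IH => j js; [apply: hs|apply: hM]; rewrite in_cons js orbT.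
Qed.

End L2norm.

Section covariance.
Context (R : realType) (H : R) (hH : 0 < H < 1).
Local Notation cov := (fbm_cov H).

Let H2 : 2 * H != 0. Proof. by rewrite mulf_neq0// gt_eqF//; case/andP: hH. Qed.

Lemma powR2H (x : R) : x `^ (2 * H) = (x `^ H) ^+ 2.
Proof. by rewrite mulrC powRrM powR_mulrn// powR_ge0. Qed.

Lemma fbm_cov_diag t : cov t t = t `^ (2 * H).
Proof. by rewrite /fbm_cov subrr normr0 powR0// subr0; field. Qed.

(** The variance of B_t - B_s. *)
Lemma fbm_cov_increment t s : cov t t - cov t s - cov s t + cov s s = `|t - s| `^ (2 * H).
Proof.
by rewrite !fbm_cov_diag /fbm_cov (distrC s t); field.
Qed.

Lemma fbm_cov_scale a t s : 0 < a -> 0 <= t -> 0 <= s ->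
  cov (a * t) (a * s) = a `^ (2 * H) * cov t s.
Proof.
move=> a0 t0 s0; have a0' := ltW a0.
rewrite /fbm_cov -mulrBr normrM (gtr0_norm a0) !powRM//; ring.
Qed.

(** Families of vectors with the covariance of the process: the process itself,
    and the kernel that represents it. *)
Context (d : measure_display) (T : measurableType d)
  (mu : {measure set T -> \bar R}) (D : set T) (mD : measurable D).
Context (I : set R) (e : R -> T -> R).
Hypotheses (sqe : forall t, I t -> sqint mu D (e t))
  (ipe : forall t s, I t -> I s -> ip mu D (e t) (e s) = cov t s).
Local Notation nrm := (L2norm mu D).

Definition step_comb (g : step R) (x : T) : R := \sum_(p <- g) p.1 * e p.2 x.

Definition times_in (g : step R) := forall p, p \in g -> I p.2.

Lemma lin_sqint g : times_in g -> sqint mu D (step_comb g).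
Proof. by move=> og; apply: sqint_sum => // p /og ?; apply: sqintZ => //; exact: sqe. Qed.

Lemma lin_ip g1 g2 : times_in g1 -> times_in g2 -> ip mu D (step_comb g1) (step_comb g2) = step_ip H g1 g2.
Proof.
move=> o1 o2; have s2 := lin_sqint o2.
have sZ p g : times_in g -> p \in g -> sqint mu D (fun x => p.1 * e p.2 x).
  by move=> og /og ?; apply: sqintZ => //; exact: sqe.
rewrite ip_suml//; last by move=> p pg; exact: (sZ _ _ o1).
rewrite /step_ip big_seq [RHS]big_seq; apply: eq_bigr => p pg.
have sp := sZ _ _ o1 pg.
rewrite ipC ip_suml//; last by move=> q qg; exact: (sZ _ _ o2).
rewrite big_seq [RHS]big_seq; apply: eq_bigr => q qg.
have Ip := o1 _ pg; have Iq := o2 _ qg; have sep := sqe Ip; have seq := sqe Iq.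
rewrite ipZl// ipC ipZl// ipe//; ring.
Qed.

Lemma on_sub g1 g2 : times_in g1 -> times_in g2 -> times_in (step_sub g1 g2).
Proof.
move=> o1 o2 p; rewrite mem_cat => /orP[/o1//|/mapP[q /o2 Iq ->]//].
Qed.

Lemma lin_sub g1 g2 : step_comb (step_sub g1 g2) = (fun x => step_comb g1 x - step_comb g2 x).
Proof.
apply/funext => x; rewrite /step_comb /step_sub big_cat big_map/= -sumrN.
by congr (_ + _); apply: eq_bigr => q _; rewrite mulNr.
Qed.

Lemma norm_increment t s : I t -> I s -> nrm (fun x => e t x - e s x) = `|t - s| `^ H.
Proof.
move=> It Is; have st := sqe It; have ss := sqe Is; have sB := sqintB mD st ss.
rewrite /L2norm ipBl// !(ipC _ _ _ (fun x => e t x - e s x)) !ipBl// !ipe//.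
have -> : cov t t - cov s t - (cov t s - cov s s) = cov t t - cov t s - cov s t + cov s s by ring.
by rewrite fbm_cov_increment powR2H sqrtr_sqr ger0_norm// powR_ge0.
Qed.

Lemma norm_family t : I t -> nrm (e t) = t `^ H.
Proof.
by move=> It; rewrite /L2norm ipe// fbm_cov_diag powR2H sqrtr_sqr ger0_norm// powR_ge0.
Qed.

(** Cauchy-Schwarz inequality. *)
Lemma fbm_cov_modulus t s r : I t -> I s -> I r ->
  `|cov t r - cov s r| <= `|t - s| `^ H * r `^ H.
Proof.
move=> It Is Ir; have st := sqe It; have ss := sqe Is; have sr := sqe Ir.
rewrite -!ipe// -ipBl// -norm_increment// -norm_family//.
by apply: ip_le_norm => //; exact: sqintB.
Qed.

End covariance.

(** * Smoothing of step functions *)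

Lemma sum_divn (V : nmodType) (F : nat -> V) a b : (0 < b)%N ->
  \sum_(k <- iota 0 (a * b)) F (k %/ b)%N = (\sum_(k <- iota 0 a) F k) *+ b.
Proof.
move=> b0; elim: a => [|a IH]; first by rewrite mul0n !big_nil mul0rn.
rewrite mulSn addnC iotaD big_cat IH -addn1 iotaD big_cat/= big_seq1 mulrnDl.
congr (_ + _); rewrite !add0n.
have -> : iota (a * b) b = map (addn (a * b)) (iota 0 b) by rewrite -iotaDl addn0.
rewrite big_map.
rewrite big_seq (eq_bigr (fun=> F a)); last first.
  by move=> k; rewrite mem_iota add0n => /andP[_ kb]; rewrite divnMDl// divn_small// addn0.
by rewrite -big_seq big_const_seq count_predT size_iota iter_addr_0.
Qed.

Section smoothing.
Context (R : realType) (H : R) (hH : 0 < H < 1).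
Implicit Types (g : step R) (eta T t s : R).

(** The point of [0, T] at which the step at t ends after a shift by s: the
    contraction by 1 - eta makes room for a shift of total length eta T. *)
Definition node eta T t s := (1 - eta) * t + eta * T * s.

(** Each step 1_[0, t] becomes 1_[0, node t s] - 1_[0, node 0 s]. Subtracting the
    second one cancels r^(2H) in the inner product with 1_[0, r], whose
    derivative is not square integrable near 0 when H <= 1/4. *)
Definition shift_steps eta T s g : step R :=
  [seq (p.1, node eta T p.2 s) | p <- g] ++ [seq (- p.1, node eta T 0 s) | p <- g].

(** The dyadic Riemann sum of the average of the shifts over s in [0, 1]. *)
Definition smooth eta T g n : step R :=
  flatten [seq [seq ((2 ^+ n)^-1 * q.1, q.2) | q <- shift_steps eta T (k%:R / 2 ^+ n) g]
          | k <- iota 0 (2 ^ n)].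

Lemma node_itv eta T t s : 0 <= eta <= 1 -> 0 <= t <= T -> 0 <= s <= 1 ->
  0 <= node eta T t s <= T.
Proof.
rewrite /node => /andP[e0 e1] /andP[t0 tT] /andP[s0 s1].
have T0 : 0 <= T by exact: le_trans tT.
apply/andP; split; first by rewrite addr_ge0// !mulr_ge0// subr_ge0.
have : (1 - eta) * t <= (1 - eta) * T by rewrite ler_wpM2l// subr_ge0.
have : eta * T * s <= eta * T * 1 by rewrite ler_wpM2l// mulr_ge0.
lra.
Qed.

Lemma dyadic_itv k n : k \in iota 0 (2 ^ n) -> 0 <= (k%:R / 2 ^+ n : R) <= 1.
Proof.
rewrite mem_iota add0n => /andP[_ kn]; rewrite divr_ge0 ?exprn_ge0//=.
by rewrite ler_pdivrMr ?exprn_gt0// mul1r -natrX ler_nat ltnW.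
Qed.

Lemma step_on_smooth eta T g n : 0 <= eta <= 1 -> step_on T g -> step_on T (smooth eta T g n).
Proof.
move=> e01 og q /flatten_mapP[k /dyadic_itv k01] /mapP[q' + ->] /=.
rewrite mem_cat => /orP[|] /mapP[p pg ->] /=; apply: node_itv => //; first exact: og.
by have /andP[p0 pT] := og _ pg; rewrite lexx (le_trans p0).
Qed.

Section family.
Context (T : R) (d : measure_display) (X : measurableType d)
  (mu : {measure set X -> \bar R}) (D : set X) (mD : measurable D) (e : R -> X -> R).
Let I := [set t : R | 0 <= t <= T].
Hypotheses (sqe : forall t, 0 <= t <= T -> sqint mu D (e t))
  (ipe : forall t s, 0 <= t <= T -> 0 <= s <= T -> ip mu D (e t) (e s) = fbm_cov H t s).
Local Notation nrm := (L2norm mu D).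
Context (eta : R) (eta01 : 0 <= eta <= 1) (g : step R) (og : step_on T g).

Lemma lin_smooth (E : R -> X -> R) n x : step_comb E (smooth eta T g n) x =
  \sum_(k <- iota 0 (2 ^ n)) (2 ^+ n)^-1 * step_comb E (shift_steps eta T (k%:R / 2 ^+ n) g) x.
Proof.
rewrite /step_comb /smooth big_flatten big_map; apply: eq_bigr => k _.
by rewrite big_map mulr_sumr; apply: eq_bigr => q _; rewrite mulrA.
Qed.

Lemma lin_shift (E : R -> X -> R) s x : step_comb E (shift_steps eta T s g) x =
  \sum_(p <- g) p.1 * (E (node eta T p.2 s) x - E (node eta T 0 s) x).
Proof.
rewrite /step_comb /shift_steps big_cat !big_map /= -big_split; apply: eq_bigr => p _ /=.
by rewrite mulrBr mulNr.
Qed.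

(** Each endpoint moves by at most eta T, hence each of the two steps that make
    up a shifted step by at most (eta T)^H in norm. *)
Definition smoothing_error : R := (\sum_(p <- g) `|p.1|) * (2 * (eta * T) `^ H).

Let T0 p : p \in g -> 0 <= T.
Proof. by move=> /og/andP[p0]; apply: le_trans. Qed.

Let H0 : 0 <= H. Proof. by case/andP: hH => /ltW. Qed.

Let sqB t s : 0 <= t <= T -> 0 <= s <= T -> sqint mu D (fun x => e t x - e s x).
Proof. by move=> ht hs; apply: sqintB => //; exact: sqe. Qed.

Let normB f h : sqint mu D f -> sqint mu D h -> nrm (fun x => f x - h x) <= nrm f + nrm h.
Proof.
move=> hf hh; have := L2normD mD hf (sqintZ mD (-1) hh).
rewrite L2normZ// normrN normr1 mul1r.
by under [X in nrm X]eq_fun do rewrite mulN1r.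
Qed.

Let incr t s : 0 <= t <= T -> 0 <= s <= T ->
  nrm (fun x => e t x - e s x) = `|t - s| `^ H.
Proof.
move=> ht hs; apply: (@norm_increment _ _ hH _ _ mu D mD I e) => //.
Qed.

Let size1 t : 0 <= t <= T -> nrm (e t) = t `^ H.
Proof. by move=> ht; apply: (@norm_family _ _ hH _ _ mu D I e). Qed.

Lemma shift_modulus s s' (w : R) : 0 <= s <= 1 -> 0 <= s' <= 1 -> `|s - s'| <= w ->
  nrm (fun x => step_comb e (shift_steps eta T s g) x - step_comb e (shift_steps eta T s' g) x) <= smoothing_error * w `^ H.
Proof.
move=> s01 s01' sw; have w0 : 0 <= w by exact: le_trans sw.
have -> : (fun x => step_comb e (shift_steps eta T s g) x - step_comb e (shift_steps eta T s' g) x) =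
  (fun x => \sum_(p <- g) p.1 *
    ((e (node eta T p.2 s) x - e (node eta T p.2 s') x)
     - (e (node eta T 0 s) x - e (node eta T 0 s') x))).
  apply/funext => x; rewrite !lin_shift -sumrB; apply: eq_bigr => p _; ring.
have zT p : p \in g -> 0 <= (0 : R) <= T by move=> /T0 ->; rewrite lexx.
have nI t r : 0 <= t <= T -> 0 <= r <= 1 -> 0 <= node eta T t r <= T by exact: node_itv.
rewrite /smoothing_error -mulrA; apply: L2norm_sum => // p pg.
  by apply: sqintB => //; apply: sqB; apply: nI => //; [exact: og|exact: og|exact: zT pg|exact: zT pg].
have oT := og pg; have z := zT _ pg; have Tp := T0 pg; have eT : 0 <= eta * T by rewrite mulr_ge0//; case/andP: eta01.
apply: (le_trans (normB _ _)); [by apply: sqB; exact: nI|by apply: sqB; exact: nI|].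
rewrite !incr ?nI// -mulrA -powRM//.
have bound t : `|node eta T t s - node eta T t s'| `^ H <= (eta * T * w) `^ H.
  apply: ge0_ler_powR => //; rewrite ?nnegrE; first by apply: mulr_ge0.
  have -> : node eta T t s - node eta T t s' = (eta * T) * (s - s') by rewrite /node; ring.
  by rewrite normrM ger0_norm// ler_wpM2l.
have := bound p.2; have := bound 0; lra.
Qed.

(** When both sums are written over the finer subdivision, corresponding nodes
    are at distance at most 2^(-n) times eta T. *)
Lemma smooth_cauchy n m : (n <= m)%N ->
  nrm (fun x => step_comb e (smooth eta T g m) x - step_comb e (smooth eta T g n) x)
  <= smoothing_error * ((2 ^+ n)^-1) `^ H.
Proof.
move=> nm; pose j := (m - n)%N; have mE : m = (n + j)%N by rewrite subnKC.
have pos k : 0 < (2 : R) ^+ k by rewrite exprn_gt0.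
have -> : (fun x => step_comb e (smooth eta T g m) x - step_comb e (smooth eta T g n) x) =
  (fun x => \sum_(k <- iota 0 (2 ^ m)) (2 ^+ m)^-1 *
    (step_comb e (shift_steps eta T (k%:R / 2 ^+ m) g) x
     - step_comb e (shift_steps eta T ((k %/ 2 ^ j)%:R / 2 ^+ n) g) x)).
  apply/funext => x; under eq_bigr do rewrite mulrBr.
  rewrite sumrB -lin_smooth; congr (_ - _).
  rewrite lin_smooth -!mulr_sumr mE expnD.
  rewrite (sum_divn (fun k => step_comb e (shift_steps eta T (k%:R / 2 ^+ n) g) x)) ?expn_gt0//.
  by rewrite mulrnAr -mulrnAl -[_ *+ (2 ^ j)]mulr_natr natrX exprD invfM mulfVK// gt_eqF.
have -> : smoothing_error * ((2 ^+ n)^-1) `^ H = (\sum_(k <- iota 0 (2 ^ m)) `|(2 ^+ m)^-1 : R|)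
    * (smoothing_error * ((2 ^+ n)^-1) `^ H).
  rewrite big_const_seq count_predT size_iota iter_addr_0 ger0_norm ?invr_ge0 ?ltW//.
  by rewrite -[_ *+ (2 ^ m)]mulr_natl natrX mulfV ?mul1r// gt_eqF.
have kd k : (k < 2 ^ m)%N -> (k %/ 2 ^ j < 2 ^ n)%N.
  by rewrite mE expnD => h; rewrite ltn_divLR ?expn_gt0.
have mi i k : (k < 2 ^ i)%N -> k \in iota 0 (2 ^ i) by rewrite mem_iota.
have sql s : 0 <= s <= 1 -> sqint mu D (step_comb e (shift_steps eta T s g)).
  move=> s01; apply: (@lin_sqint _ _ _ _ _ mD I) => // p.
  rewrite mem_cat => /orP[|] /mapP[q qg ->] /=; apply: node_itv => //; first exact: og.
  by rewrite lexx/= (T0 qg).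
apply: L2norm_sum => // k /[dup] km; rewrite mem_iota add0n => /andP[_ klt].
  by apply: sqintB => //; apply: sql; apply: dyadic_itv => //; exact/mi/kd.
apply: shift_modulus; [exact: dyadic_itv|by apply: dyadic_itv; exact/mi/kd|].
rewrite {1}(divn_eq k (2 ^ j)) natrD natrM mE exprD natrX invfM.
set q := (k %/ 2 ^ j)%:R; set r := (k %% 2 ^ j)%N.
have -> : (q * 2 ^+ j + r%:R) * ((2 ^+ n)^-1 * (2 ^+ j)^-1) - q / 2 ^+ n
   = (2 ^+ n)^-1 * (r%:R / 2 ^+ j) :> R.
  by field; rewrite !gt_eqF.
have r01 : 0 <= (r%:R / 2 ^+ j : R) <= 1.
  by apply: dyadic_itv; rewrite mem_iota add0n ltn_pmod// expn_gt0.
case/andP: r01 => r0 r1.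
by rewrite ger0_norm ?mulr_ge0 ?invr_ge0 ?(ltW (pos _))// ler_piMr// invr_ge0 ltW.
Qed.

Lemma smooth_close n : nrm (fun x => step_comb e (smooth eta T g n) x - step_comb e g x) <= smoothing_error.
Proof.
have pos k : 0 < (2 : R) ^+ k by rewrite exprn_gt0.
have one : \sum_(k <- iota 0 (2 ^ n)) ((2 ^+ n)^-1 : R) = 1.
  rewrite big_const_seq count_predT size_iota iter_addr_0.
  by rewrite -[_ *+ (2 ^ n)]mulr_natl natrX mulfV// gt_eqF.
have -> : (fun x => step_comb e (smooth eta T g n) x - step_comb e g x) =
  (fun x => \sum_(k <- iota 0 (2 ^ n)) (2 ^+ n)^-1 *
    (step_comb e (shift_steps eta T (k%:R / 2 ^+ n) g) x - step_comb e g x)).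
  apply/funext => x; under eq_bigr do rewrite mulrBr.
  by rewrite sumrB -lin_smooth -mulr_suml one mul1r.
have -> : smoothing_error = (\sum_(k <- iota 0 (2 ^ n)) `|(2 ^+ n)^-1 : R|) * smoothing_error.
  by under eq_bigr do rewrite ger0_norm ?invr_ge0 ?ltW//; rewrite one mul1r.
have zT p : p \in g -> 0 <= (0 : R) <= T by move=> /T0 ->; rewrite lexx.
have nI t r : 0 <= t <= T -> 0 <= r <= 1 -> 0 <= node eta T t r <= T by exact: node_itv.
have E s : (fun x => step_comb e (shift_steps eta T s g) x - step_comb e g x) =
    (fun x => \sum_(p <- g) p.1 * ((e (node eta T p.2 s) x - e p.2 x) - e (node eta T 0 s) x)).
  apply/funext => x; rewrite lin_shift /step_comb -sumrB; apply: eq_bigr => p _; ring.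
have sq1 s p : 0 <= s <= 1 -> p \in g ->
    sqint mu D (fun x => (e (node eta T p.2 s) x - e p.2 x) - e (node eta T 0 s) x).
  move=> s01 pg; have z := zT _ pg; have op := og pg.
  by apply: sqintB => //; [apply: sqB => //; exact: nI|apply: sqe; exact: nI].
apply: L2norm_sum => // k kn; have k01 := dyadic_itv kn.
  by rewrite E; apply: sqint_sum => // p pg; apply: sqintZ => //; exact: sq1.
rewrite E; apply: L2norm_sum => // p pg; first exact: sq1.
have z := zT _ pg; have op := og pg; have Tp := T0 pg.
have eT : 0 <= eta * T by rewrite mulr_ge0//; case/andP: eta01.
set s := _ / _ in k01 *.
apply: (le_trans (normB _ _)); [by apply: sqB => //; exact: nI|by apply: sqe; exact: nI|].
rewrite incr ?nI// size1 ?nI//.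
have b1 : `|node eta T p.2 s - p.2| `^ H <= (eta * T) `^ H.
  apply: ge0_ler_powR => //; rewrite ?nnegrE//.
  have -> : node eta T p.2 s - p.2 = eta * (T * s - p.2) by rewrite /node; ring.
  case/andP: eta01 => e0 e1; rewrite normrM (ger0_norm e0) ler_wpM2l//.
  case/andP: k01 => s0 s1; case/andP: op => p0 pT.
  have : 0 <= T * s by rewrite mulr_ge0.
  have : T * s <= T by rewrite ler_piMr.
  by move=> ? ?; rewrite ler_norml; apply/andP; split; lra.
have b2 : node eta T 0 s `^ H <= (eta * T) `^ H.
  have /andP[n0 _] := nI _ _ z k01.
  apply: ge0_ler_powR => //; rewrite ?nnegrE//.
  by rewrite /node mulr0 add0r ler_piMr//; case/andP: k01.
lra.
Qed.

End family.
End smoothing.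

(** * Primitives of the covariance and Riemann sums *)

Section absolute_power.
Context (R : realType) (p : R) (p0 : 0 < p).

Definition abspow (x : R) : R := `|x| `^ p.
Definition abspow_prim (x : R) : R := x * `|x| `^ p / (p + 1).

Let p1 : p + 1 != 0. Proof. by rewrite gt_eqF// ltr_wpDr. Qed.

Lemma abspowN x : abspow (- x) = abspow x.
Proof. by rewrite /abspow normrN. Qed.

Lemma continuous_abspow : continuous abspow.
Proof.
move=> x; have [->|x0] := eqVneq x 0; last first.
  have nx : 0 < `|x| by rewrite normr_gt0.
  rewrite -[abspow]/((@powR R ^~ p) \o Num.norm); apply: continuous_comp.
    exact: norm_continuous.
  have [d _] := is_derive1_powR p nx.
  exact/differentiable_continuous/derivable1_diffP.
rewrite /continuous_at; have -> : abspow 0 = 0 by rewrite /abspow normr0 powR0// gt_eqF.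
apply/cvgr0Pnorm_lt => eps eps0; near=> t.
rewrite ger0_norm ?powR_ge0//.
have -> : eps = (eps `^ p^-1) `^ p by rewrite -powRrM mulVf ?gt_eqF// powRr1// ltW.
rewrite /abspow gt0_ltr_powR ?nnegrE ?powR_ge0//.
near: t; apply/nbhs_ballP; exists (eps `^ p^-1); first exact: powR_gt0.
by move=> y; rewrite /ball/= sub0r normrN.
Unshelve. all: by end_near. Qed.

(** At 0 the slope of the chord is |z|^p / (p + 1), which tends to 0. *)
Lemma is_derive_abspow_prim (x : R) : is_derive x (1 : R) abspow_prim (abspow x).
Proof.
have pos (y : R) : 0 < y -> is_derive y (1 : R) abspow_prim (abspow y).
  move=> y0; apply: (@near_eq_is_derive _ _ _ (fun z => (p + 1)^-1 *: z `^ (p + 1) : R)).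
    near=> z; have z0 : 0 < z by near: z; exact: lt_nbhsr.
    rewrite /abspow_prim gtr0_norm// powRD ?powRr1 ?ltW//; last by rewrite (gt_eqF z0) implybT.
    by rewrite -[LHS]/(_ * _) mulrC (mulrC z).
  have h := is_derive1_powR (p + 1) y0; apply: is_derive_eq.
  by rewrite scalerA mulVf// scale1r addrK /abspow gtr0_norm.
have [x0|x0|<-] := ltgtP 0 x; first exact: pos.
- have -> : abspow_prim = (fun y => - abspow_prim (- y)).
    by apply/funext => y; rewrite /abspow_prim normrN !mulNr opprK.
  have h : is_derive (- x) (1 : R) abspow_prim (abspow (- x)) by apply: pos; rewrite oppr_gt0.
  have c := @is_derive1_comp _ abspow_prim -%R x _ _ h (is_deriveNid x 1).
  have := is_deriveN c.
  by move=> d; apply: is_derive_eq; rewrite abspowN mulrN1 opprK.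
- apply/is_derive1_caratheodory; exists (fun z => abspow z / (p + 1)); split.
  + by move=> z; rewrite /abspow_prim /abspow !mul0r !subr0 -mulrA mulrC.
  + by apply: cvgMl; exact: continuous_abspow.
  + by rewrite /abspow normr0 powR0 ?gt_eqF// mul0r.
Unshelve. all: by end_near. Qed.

End absolute_power.

Section smoothing_limit.
Context (R : realType) (H : R) (hH : 0 < H < 1).

Definition half_pow : R := 2^-1 `^ H.

Lemma half_powX n : (2 ^+ n)^-1 `^ H = half_pow ^+ n.
Proof.
elim: n => [|n IH]; first by rewrite !expr0 invr1 powR1.
by rewrite !exprS invfM powRM ?invr_ge0 ?exprn_ge0// IH.
Qed.

Lemma half_pow_itv : 0 < half_pow < 1.
Proof.
case/andP: hH => H0 _; rewrite powR_gt0 ?invr_gt0//=.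
have -> : 1 = 1 `^ H :> R by rewrite powR1.
by apply: gt0_ltr_powR; rewrite ?nnegrE//; lra.
Qed.

Lemma cvg_half_pow (c : R) : (fun n => c * half_pow ^+ n) @ \oo --> 0.
Proof.
have /andP[h0 h1] := half_pow_itv.
by apply: (@cvg_geometric R c half_pow); rewrite gtr0_norm.
Qed.

Lemma cvg_half_pow_bound (u : R ^nat) (l c : R) :
  (forall n, `|u n - l| <= c * half_pow ^+ n) -> u @ \oo --> l.
Proof.
move=> h; apply/subr_cvg0/norm_cvg0P.
apply: (@squeeze_cvgr _ _ _ _ (fun=> 0) (fun n => c * half_pow ^+ n)).
- by apply: nearW => n; rewrite h normr_ge0.
- exact: cvg_cst.
- exact: cvg_half_pow.
Qed.

Context (d : measure_display) (X : measurableType d)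
  (mu : {measure set X -> \bar R}) (D : set X) (mD : measurable D).
Local Notation nrm := (L2norm mu D).

Lemma cvg_L2norm0 (f : nat -> X -> R) (c : R) : (forall n, sqint mu D (f n)) ->
  (forall n, nrm (f n) <= c * half_pow ^+ n) ->
  (fun n => \int[mu]_(x in D) (f n x ^+ 2)%:E)%E @ \oo --> 0%E.
Proof.
move=> sf hf; under eq_fun do rewrite ip_integral//.
apply: cvg_EFin; first exact: nearW.
apply: (@squeeze_cvgr _ _ _ _ (fun=> 0) (fun n => (c * half_pow ^+ n) * (c * half_pow ^+ n))).
- apply: nearW => n /=; rewrite ip_ge0/= -L2norm_sqr expr2.
  by rewrite ler_pM ?L2norm_ge0.
- exact: cvg_cst.
- rewrite -[X in _ --> X](mulr0 (0 : R)); apply: cvgM; exact: cvg_half_pow.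
Qed.

Context (T : R) (e : R -> X -> R).
Hypotheses (sqe : forall t, 0 <= t <= T -> sqint mu D (e t))
  (ipe : forall t s, 0 <= t <= T -> 0 <= s <= T -> ip mu D (e t) (e s) = fbm_cov H t s).
Context (eta : R) (eta01 : 0 <= eta <= 1) (g : step R) (og : step_on T g).

Lemma lin_on_sqint k : step_on T k -> sqint mu D (step_comb e k).
Proof. by move=> ok; apply: (@lin_sqint _ _ _ _ _ mD [set t | 0 <= t <= T]). Qed.

(** The Wiener integral of the averaged step function when the family is the
    process, its image under K_H^* when the family is the kernel. *)
Lemma smooth_limit : exists2 F, sqint mu D F &
  forall n, nrm (fun x => F x - step_comb e (smooth eta T g n) x)
    <= smoothing_error H T eta g * half_pow ^+ n.
Proof.
have /andP[h0 h1] := half_pow_itv.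
have p01 : 0 < Num.sqrt half_pow < 1.
  by rewrite sqrtr_gt0 h0/= -sqrtr1 ltr_sqrt.
have err0 : 0 <= smoothing_error H T eta g.
  rewrite /smoothing_error mulr_ge0 ?sumr_ge0// mulr_ge0// powR_ge0.
  by [].
have p4 : Num.sqrt half_pow ^+ 4 = half_pow ^+ 2.
  by rewrite (exprM _ 2 2) sqr_sqrtr// ltW.
have sqs n : sqint mu D (step_comb e (smooth eta T g n)).
  by apply: lin_on_sqint; exact: step_on_smooth.
have [|F sF hF] := @RieszFischer _ _ _ mu D mD (fun n => step_comb e (smooth eta T g n))
   (smoothing_error H T eta g ^+ 2) _ p01 sqs.
  move=> n m nm; rewrite -L2norm_sqr p4 -exprM mulnC exprM -exprMn.
  have le := smooth_cauchy hH mD sqe ipe eta01 og nm.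
  by rewrite !expr2 ler_pM ?L2norm_ge0// -half_powX.
exists F => // n.
have b0 : 0 <= smoothing_error H T eta g * half_pow ^+ n.
  by apply: mulr_ge0 => //; rewrite exprn_ge0// ltW.
rewrite -(@ler_pXn2r _ 2)// ?nnegrE ?L2norm_ge0//.
by rewrite L2norm_sqr (le_trans (hF n))// p4 -exprM mulnC exprM -exprMn.
Qed.

End smoothing_limit.

Section covariance_primitive.
Context (R : realType) (H : R) (hH : 0 < H < 1).
Local Notation cov := (fbm_cov H).
Local Notation pow := (abspow (2 * H)).
Local Notation prim := (abspow_prim (2 * H)).

Let H2 : 0 < 2 * H. Proof. by rewrite mulr_gt0//; case/andP: hH. Qed.

Definition cov_prim (r x : R) : R := 2^-1 * (prim x + x * pow r - prim (x - r)).

Lemma is_derive_prim_shift r (x : R) : is_derive x (1 : R) (fun x => prim (x - r)) (pow (x - r)).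
Proof.
have h := is_derive_abspow_prim H2 (x - r).
have s : is_derive x (1 : R) (fun x => x - r) 1.
  by apply: is_derive_eq; rewrite subr0.
by have := @is_derive1_comp _ prim (fun y => y - r) x _ _ h s; rewrite mulr1.
Qed.

Lemma is_derive_cov_prim r (x : R) : 0 <= r -> 0 <= x ->
  is_derive x (1 : R) (cov_prim r) (cov x r).
Proof.
move=> r0 x0.
have h0 := is_derive_abspow_prim H2 x; have h1 := is_derive_prim_shift r x.
rewrite /cov_prim.
apply: is_derive_eq.
rewrite /GRing.scale /= mulr0 mulr1 /fbm_cov /abspow (ger0_norm r0) (ger0_norm x0).
ring.
Qed.

(** Averaging f' over a shift replaces it by difference quotients of f, at t and
    at 0; it kills affine functions, among them the term x r^(2H) of
    [cov_prim]. *)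
Definition second_difference (eta T t : R) (f : R -> R) : R :=
  f (node eta T t 1) - f (node eta T t 0) - (f (node eta T 0 1) - f (node eta T 0 0)).

Lemma second_difference_cov_prim eta T t r :
  second_difference eta T t (cov_prim r) =
  2^-1 * (second_difference eta T t prim - second_difference eta T t (fun x => prim (x - r))).
Proof. by rewrite /second_difference /cov_prim /node; ring. Qed.

Section riemann_sums.
Context (T eta r : R).
Hypothesis modulus : forall t s, 0 <= t <= T -> 0 <= s <= T ->
  `|cov t r - cov s r| <= `|t - s| `^ H * r `^ H.
Hypotheses (eta01 : 0 < eta <= 1) (T0 : 0 < T) (r0 : 0 <= r).

Let eT : 0 < eta * T. Proof. by rewrite mulr_gt0//; case/andP: eta01. Qed.

(** Mean value theorem on each interval of the subdivision. *)
Lemma riemann_sum_error t n : 0 <= t <= T ->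
  `|\sum_(k <- iota 0 (2 ^ n)) (2 ^+ n)^-1 * cov (node eta T t (k%:R / 2 ^+ n)) r
    - (cov_prim r (node eta T t 1) - cov_prim r (node eta T t 0)) / (eta * T)|
  <= (eta * T) `^ H * r `^ H * half_pow H ^+ n.
Proof.
move=> tT; have eta01' : 0 <= eta <= 1 by case/andP: eta01 => /ltW -> ->.
have pos : 0 < (2 : R) ^+ n by rewrite exprn_gt0.
pose y k := node eta T t (k%:R / 2 ^+ n).
have yS k : y k.+1 - y k = eta * T / 2 ^+ n.
  by rewrite /y /node -natr1; field; rewrite gt_eqF.
have yI k : (k <= 2 ^ n)%N -> 0 <= y k <= T.
  move=> kn; apply: node_itv => //; rewrite divr_ge0 ?exprn_ge0//=.
  by rewrite ler_pdivrMr// mul1r -natrX ler_nat.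
have mvt k : (k < 2 ^ n)%N -> exists2 c, y k <= c <= y k.+1 &
    cov_prim r (y k.+1) - cov_prim r (y k) = cov c r * (eta * T / 2 ^+ n).
  move=> kn; have /andP[y0 _] := yI k (ltnW kn).
  have lt : y k < y k.+1 by rewrite -subr_gt0 yS divr_gt0.
  have d x : y k <= x -> is_derive x (1 : R) (cov_prim r) (cov x r).
    by move=> yx; apply: is_derive_cov_prim => //; exact: le_trans yx.
  have d1 x : x \in `]y k, y k.+1[ -> is_derive x (1 : R) (cov_prim r) (cov x r).
    by rewrite in_itv/= => /andP[/ltW yx _]; exact: d.
  have d2 : {within `[y k, y k.+1], continuous (cov_prim r)}.
    apply: derivable_within_continuous => x; rewrite in_itv/= => /andP[yx _].
    by have [] := d _ yx.
  have [c cI e] := MVT lt d1 d2; exists c; last by rewrite e yS.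
  by move: cI; rewrite in_itv/= => /andP[/ltW -> /ltW ->].
have tele : cov_prim r (node eta T t 1) - cov_prim r (node eta T t 0) =
    \sum_(k <- iota 0 (2 ^ n)) (cov_prim r (y k.+1) - cov_prim r (y k)).
  have := @telescope_sumr _ 0 (2 ^ n) (fun k => cov_prim r (y k)) (leq0n _).
  rewrite /index_iota subn0 => ->.
  by rewrite /y mul0r natrX divff// gt_eqF.
rewrite tele mulr_suml -sumrB big_seq.
apply: (le_trans (ler_norm_sum _ _ _)).

have one : \sum_(k <- iota 0 (2 ^ n)) ((2 ^+ n)^-1 : R) = 1.
  rewrite big_const_seq count_predT size_iota iter_addr_0.
  by rewrite -[_ *+ (2 ^ n)]mulr_natl natrX mulfV// gt_eqF.
rewrite -[leRHS]mul1r -[X in _ <= X * _]one mulr_suml [leRHS]big_seq; apply: ler_sum => k.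
rewrite mem_iota add0n => /andP[_ kn].
have [c /andP[c1 c2] ->] := mvt k kn.
have -> : (2 ^+ n)^-1 * cov (node eta T t (k%:R / 2 ^+ n)) r
    - cov c r * (eta * T / 2 ^+ n) / (eta * T) = (2 ^+ n)^-1 * (cov (y k) r - cov c r).
  by rewrite /y; field; rewrite !gt_eqF//; case/andP: eta01.
have i0 : 0 <= (2 ^+ n)^-1 :> R by rewrite invr_ge0 ltW.
rewrite normrM (ger0_norm i0) ler_wpM2l//.
have /andP[yk0 ykT] := yI _ (ltnW kn); have /andP[yS0 ySI] := yI _ kn.
apply: (le_trans (modulus _ _)); [by apply/andP; split|by apply/andP; split; lra|].
rewrite mulrAC ler_wpM2r ?powR_ge0// -half_powX -(powRM _ (ltW eT) i0).
have /andP[H0 _] := hH.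
apply: ge0_ler_powR; rewrite ?nnegrE ?normr_ge0//; first exact: ltW.
  by rewrite divr_ge0// ltW.
by have := yS k; rewrite ler_norml => ?; apply/andP; split; lra.
Qed.

Lemma cvg_riemann_sum t : 0 <= t <= T ->
  (fun n => \sum_(k <- iota 0 (2 ^ n)) (2 ^+ n)^-1 * cov (node eta T t (k%:R / 2 ^+ n)) r)
  @ \oo --> (cov_prim r (node eta T t 1) - cov_prim r (node eta T t 0)) / (eta * T).
Proof.
move=> tT; apply: (cvg_half_pow_bound hH) => n; exact: riemann_sum_error.
Qed.

End riemann_sums.
End covariance_primitive.

(** * The adjoint of the kernel operator on smoothed steps *)

Lemma is_derive_sum_seq (R : realType) (I : Type) (s : seq I) (f df : I -> R -> R) (x : R) :
  (forall i, is_derive x (1 : R) (f i) (df i x)) ->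
  is_derive x (1 : R) (fun y => \sum_(i <- s) f i y) (\sum_(i <- s) df i x).
Proof.
move=> h; elim: s => [|i s IH].
  under eq_fun do rewrite big_nil.
  by rewrite big_nil; exact: is_derive_cst.
under eq_fun do rewrite big_cons.
by rewrite big_cons; exact: is_deriveD.
Qed.

Lemma continuous_sum_seq (R : realType) (I : Type) (s : seq I) (f : I -> R -> R) :
  (forall i, continuous (f i)) -> continuous (fun y => \sum_(i <- s) f i y).
Proof.
move=> h x; elim: s => [|i s IH].
  under eq_fun do rewrite big_nil.
  exact: cvg_cst.
under eq_fun do rewrite big_cons.
by apply: cvgD => //; exact: h.
Qed.

Section test_density.
Context (R : realType) (H : R) (hH : 0 < H < 1).
Local Notation mu := (@lebesgue_measure R).
Local Notation cov := (fbm_cov H).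
Local Notation pow := (abspow (2 * H)).
Local Notation prim := (abspow_prim (2 * H)).
Implicit Types (T eta r u : R) (g : step R).

Let H2 : 0 < 2 * H. Proof. by rewrite mulr_gt0//; case/andP: hH. Qed.

(** The image under K_H^{*,a} K_H^* of the smoothed step function, namely the
    derivative of r |-> E (Z B_r) where Z is its Wiener integral. *)
Definition test_density eta T g u : R :=
  \sum_(p <- g) p.1 / (2 * (eta * T)) * second_difference eta T p.2 (fun x => pow (x - u)).

Definition test_density_prim eta T g u : R :=
  \sum_(p <- g) p.1 / (2 * (eta * T)) * - second_difference eta T p.2 (fun x => prim (x - u)).

Let cont_shift x : continuous (fun u => pow (x - u)).
Proof.
move=> u; apply: (@continuous_comp _ _ _ (fun u => x - u) pow).
  by apply: cvgB; [exact: cvg_cst|exact: cvg_id].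
exact: continuous_abspow.
Qed.

Lemma continuous_test_density eta T g : continuous (test_density eta T g).
Proof.
apply: continuous_sum_seq => p u; apply: cvgMr.
by apply: cvgB; apply: cvgB; exact: cont_shift.
Qed.

Let derive_shift x u : is_derive u (1 : R) (fun u => prim (x - u)) (- pow (x - u)).
Proof.
have h := is_derive_abspow_prim H2 (x - u).
have s : is_derive u (1 : R) (fun u => x - u) (-1).
  by apply: is_derive_eq; rewrite add0r mul1r.
by have := @is_derive1_comp _ prim (fun y => x - y) u _ _ h s; rewrite mulrN1.
Qed.

Lemma is_derive_test_density_prim eta T g u :
  is_derive u (1 : R) (test_density_prim eta T g) (test_density eta T g u).
Proof.
apply: (@is_derive_sum_seq _ _ _ _ (fun p u =>
  p.1 / (2 * (eta * T)) * second_difference eta T p.2 (fun x => pow (x - u)))) => p.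
rewrite /second_difference.
have d1 := derive_shift (node eta T p.2 1) u.
have d2 := derive_shift (node eta T p.2 0) u.
have d3 := derive_shift (node eta T 0 1) u.
have d4 := derive_shift (node eta T 0 0) u.
have d12 := is_deriveB d1 d2; have d34 := is_deriveB d3 d4.
have d := is_deriveZ (p.1 / (2 * (eta * T))) (is_deriveN (is_deriveB d12 d34)).
apply: (is_derive_eq d); rewrite /GRing.scale /=; ring.
Qed.

Lemma integral_test_density eta T g r : 0 <= r ->
  \int[mu]_(u in `[0, r]) test_density eta T g u =
  test_density_prim eta T g r - test_density_prim eta T g 0.
Proof.
rewrite le_eqVlt => /predU1P[<-|r0].
  by rewrite set_itv1 Rintegral_set1 subrr.
have dp u : derivable (test_density_prim eta T g) u 1.
  by have [] := is_derive_test_density_prim eta T g u.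
have cp : continuous (test_density_prim eta T g).
  by move=> u; exact/differentiable_continuous/derivable1_diffP.
rewrite /Rintegral (@continuous_FTC2 _ _ (test_density_prim eta T g))//.
- by apply: continuous_subspaceT; exact: continuous_test_density.
- split => //; first by apply: cvg_at_right_filter; exact: cp.
  by apply: cvg_at_left_filter; exact: cp.
- move=> u _; rewrite derive1E.
  by have [_ ->] := is_derive_test_density_prim eta T g u.
Qed.

Lemma test_density_L2 eta T g : L2on T (test_density eta T g).
Proof.
have cq := @continuous_test_density eta T g.
have mq : measurable_fun `[0, T] (test_density eta T g).
  by apply: measurable_funTS; exact: continuous_measurable_fun.
rewrite -[L2on _ _]/(sqint mu `[0, T] (test_density eta T g)); apply: integrable_sqint => //.
apply: (@continuous_compact_integrable _ (fun u => test_density eta T g u ^+ 2)).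
  exact: segment_compact.
apply: continuous_subspaceT => u.
apply: (@continuous_comp _ _ _ (test_density eta T g) (fun x => x ^+ 2)); first exact: cq.
exact: exprn_continuous.
Qed.

(** The powers are homogeneous of degree 2H, and the length eta T in the
    denominator of degree 1. *)
Lemma test_density_scale a eta T g u : 0 < a ->
  test_density eta (a * T) [seq (p.1, a * p.2) | p <- g] (a * u) =
  a `^ (2 * H) / a * test_density eta T g u.
Proof.
move=> a0; rewrite /test_density big_map mulr_sumr; apply: eq_bigr => p _ /=.
have nodeE t s : node eta (a * T) (a * t) s = a * node eta T t s.
  by rewrite /node; ring.
have powE x : pow (a * x - a * u) = a `^ (2 * H) * pow (x - u).
  by rewrite /abspow -mulrBr normrM powRM// gtr0_norm.
have node0 s : node eta (a * T) 0 s = a * node eta T 0 s.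
  by rewrite -nodeE mulr0.
rewrite /second_difference !node0 !nodeE !powE.
set A := pow _; set B := pow _; set C := pow _; set D := pow _.
rewrite (_ : 2 * (eta * (a * T)) = a * (2 * (eta * T))); last by ring.
rewrite invfM; ring.
Qed.

Context (d : measure_display) (X : measurableType d)
  (m : {measure set X -> \bar R}) (D : set X) (mD : measurable D).
Context (T eta : R) (e : R -> X -> R).
Hypotheses (sqe : forall t, 0 <= t <= T -> sqint m D (e t))
  (ipe : forall t s, 0 <= t <= T -> 0 <= s <= T -> ip m D (e t) (e s) = cov t s).
Hypotheses (T0 : 0 < T) (eta01 : 0 < eta <= 1).

Let eta01' : 0 <= eta <= 1. Proof. by case/andP: eta01 => /ltW -> ->. Qed.

Lemma ip_lin_one g r : step_on T g -> 0 <= r <= T ->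
  ip m D (step_comb e g) (e r) = \sum_(p <- g) p.1 * cov p.2 r.
Proof.
move=> og rT; rewrite ip_suml//; last 2 first.
- by move=> p /og ?; apply: sqintZ => //; exact: sqe.
- exact: sqe.
rewrite big_seq [RHS]big_seq; apply: eq_bigr => p /og pT.
by rewrite ipZl ?ipe//; exact: sqe.
Qed.

(** The inner products with 1_[0, r] are Riemann sums of R_H(., r); their limit
    and the integral of the density are the same second difference of
    primitives. *)
Lemma cvg_ip_smooth g r : step_on T g -> 0 <= r <= T ->
  (fun n => ip m D (step_comb e (smooth eta T g n)) (e r)) @ \oo -->
  \int[mu]_(u in `[0, r]) test_density eta T g u.
Proof.
move=> og rT; have /andP[r0 _] := rT.
have modulus t s : 0 <= t <= T -> 0 <= s <= T ->
  `|cov t r - cov s r| <= `|t - s| `^ H * r `^ H.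
  move=> tT sT; apply: (@fbm_cov_modulus _ _ hH _ _ m D mD [set t | 0 <= t <= T] e) => //.
pose A n t := \sum_(k <- iota 0 (2 ^ n)) (2 ^+ n)^-1 * cov (node eta T t (k%:R / 2 ^+ n)) r.
have -> : (fun n => ip m D (step_comb e (smooth eta T g n)) (e r)) =
    (fun n => \sum_(p <- g) p.1 * (A n p.2 - A n 0)).
  apply/funext => n; rewrite ip_lin_one//; last exact: step_on_smooth.
  rewrite -[LHS]/(step_comb (fun t (_ : unit) => cov t r) (smooth eta T g n) tt) lin_smooth.
  under eq_bigr do rewrite lin_shift mulr_sumr.
  rewrite exchange_big /=; apply: eq_bigr => p _.
  rewrite /A -sumrB mulr_sumr; apply: eq_bigr => k _; ring.
have -> : \int[mu]_(u in `[0, r]) test_density eta T g u =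
    \sum_(p <- g) p.1 * (second_difference eta T p.2 (cov_prim H r) / (eta * T)).
  rewrite integral_test_density// /test_density_prim -sumrB; apply: eq_bigr => p _.
  rewrite second_difference_cov_prim.
  have -> : second_difference eta T p.2 (fun x => prim (x - 0)) = second_difference eta T p.2 prim.
    by rewrite /second_difference !subr0.
  by field; rewrite (gt_eqF T0) gt_eqF//; case/andP: eta01.
have cA t : 0 <= t <= T -> (fun n => A n t) @ \oo -->
    (cov_prim H r (node eta T t 1) - cov_prim H r (node eta T t 0)) / (eta * T).
  by move=> tT; exact: cvg_riemann_sum.
have oT : 0 <= (0 : R) <= T by rewrite lexx ltW.
elim: g og => [|p g IH] og.
  under eq_fun do rewrite big_nil; rewrite big_nil; exact: cvg_cst.
under eq_fun do rewrite big_cons; rewrite big_cons; apply: cvgD.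
  apply: cvgMr; rewrite /second_difference mulrBl; apply: cvgB; apply: cA => //.
  by apply: og; rewrite mem_head.
by apply: IH => q qg; apply: og; rewrite in_cons qg orbT.
Qed.

End test_density.

Section kernel_side.
Context (R : realType) (H : R) (hH : 0 < H < 1).
Local Notation mu := (@lebesgue_measure R).
Context (K : R -> R -> R) (hK : volterra_kernel H K) (T : R) (T0 : 0 < T).

(** K_H^* 1_[0, t]. *)
Definition kernel_family (t s : R) : R := K t s * \1_(`[0, t]) s.

Let D : set R := `[0, T].
Let mD : measurable D. Proof. exact: measurable_itv. Qed.

Let famE t : kernel_family t = K t \_ `[0, t].
Proof.
apply/funext => s; rewrite patchE /kernel_family indicE.
by case: ifP => _; rewrite ?mulr1 ?mulr0.
Qed.

Lemma kernel_family_sqint t : 0 <= t <= T -> sqint mu D (kernel_family t).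
Proof.
move=> /andP[t0 tT]; have [mk kfin] := kernel_L2 hK t0.
have mk' : measurable_fun setT (kernel_family t).
  by rewrite famE; apply/(measurable_restrictT _ (measurable_itv _)).
split; first exact: measurable_funTS.
apply: le_lt_trans kfin.
rewrite [leRHS]integral_mkcond [leLHS]integral_mkcond.
apply: ge0_le_integral => //.
- move=> s _; rewrite patchE; case: ifP => // _; by rewrite lee_fin sqr_ge0.
- apply/(measurable_restrictT _ mD)/measurable_funTS/measurable_EFinP.
  exact: measurable_funX.
- apply/(measurable_restrictT _ (measurable_itv _))/measurable_EFinP.
  exact: measurable_funX.
- move=> s _; rewrite !patchE famE patchE.
  case: ifP => _; case: ifP => _ //; rewrite ?lee_fin ?sqr_ge0// expr0n//.
Qed.

Lemma kernel_family_ip t s : 0 <= t <= T -> 0 <= s <= T ->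
  ip mu D (kernel_family t) (kernel_family s) = fbm_cov H t s.
Proof.
move=> /andP[t0 tT] /andP[s0 sT]; rewrite -(kernel_cov hK t0 s0) /ip.
rewrite Rintegral_mkcond [RHS]Rintegral_mkcond; apply: eq_Rintegral => u _.
rewrite !famE !patchE !mem_setE !in_itv/=.
have pt : point = 0 :> R by [].
rewrite le_min !pt; case: (0 <= u) => //=.
have [ut|ut] := leP u t; have [us|us] := leP u s; rewrite /= ?mulr0 ?mul0r;
  try by case: ifP.
by rewrite (le_trans ut tT).
Qed.

Context (eta : R) (eta01 : 0 < eta <= 1) (g : step R) (og : step_on T g).

Let eta01' : 0 <= eta <= 1. Proof. by case/andP: eta01 => /ltW -> ->. Qed.

(** Tested against 1_[0, r], the adjoint relation is the limit of the inner
    products of the smoothed steps with 1_[0, r]. *)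
Lemma smooth_KstaraKstar :
  is_KstaraKstar K T (smooth eta T g) (test_density H eta T g).
Proof.
have sqe := kernel_family_sqint; have ipe := kernel_family_ip.
have [h sh hh] := @smooth_limit _ _ hH _ _ mu D mD T kernel_family sqe ipe _ eta01' _ og.
have sqs n : sqint mu D (step_comb kernel_family (smooth eta T g n)).
  by apply: (@lin_on_sqint _ _ _ mu D mD T kernel_family sqe); exact: step_on_smooth.
have sqB n : sqint mu D (fun s => h s - step_comb kernel_family (smooth eta T g n) s).
  exact: (sqintB _ sh (sqs n)).
exists h; split => //.
- exact: (@cvg_L2norm0 _ _ hH _ _ mu D mD _ _ sqB hh).
- exact: test_density_L2.
move=> k ok.
have sd := test_density_L2 hH eta T g.
have limE r : 0 <= r <= T ->
    ip mu D h (kernel_family r) = \int[mu]_(u in `[0, r]) test_density H eta T g u.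
  move=> rT; have c1 := @cvg_ip_smooth _ _ hH _ _ mu D mD _ _ _ sqe ipe T0 eta01 _ _ og rT.
  have c2 : (fun n => ip mu D (step_comb kernel_family (smooth eta T g n)) (kernel_family r))
      @ \oo --> ip mu D h (kernel_family r).
    apply: (cvg_half_pow_bound hH
      (c := smoothing_error H T eta g * L2norm mu D (kernel_family r))) => n.
    have sr := sqe r rT.
    rewrite distrC -ipBl// mulrAC.
    have b := @ip_le_norm _ _ _ mu D mD _ _ (sqB n) sr.
    apply: (le_trans b).
    by apply: ler_wpM2r; [exact: L2norm_ge0|exact: hh].
  exact: (cvg_unique _ c2 c1).
have sqi r : sqint mu D (\1_(`[0, r]) : R -> R).
  apply: integrable_sqint; first exact: measurable_indic.
  have -> : (fun x : R => ((\1_(`[0, r]) x : R) ^+ 2)%:E) = (fun x => (\1_(`[0%R, r]) x)%:E).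
    by apply/funext => x; rewrite indicE; case: (_ \in _); rewrite ?expr1n ?expr0n.
  apply: (@integrableS _ _ _ _ setT) => //.
  exact: integrable_indic_itv.
transitivity (\sum_(p <- k) p.1 * ip mu D h (kernel_family p.2)).
  rewrite -[LHS]/(ip mu D (test_density H eta T g) (fun x => \sum_(p <- k) p.1 * \1_(`[0, p.2]) x)).
  rewrite ipC ip_suml//; last by move=> p _; exact: sqintZ.
  rewrite big_seq [RHS]big_seq; apply: eq_bigr => p pk.
  have pT := ok _ pk; rewrite ipZl// limE//; congr (_ * _).
  rewrite /ip Rintegral_mkcond [RHS]Rintegral_mkcond; apply: eq_Rintegral => u _.
  rewrite !patchE indicE !mem_setE !in_itv/=.
  case: (0 <= u) => //=; have [up|up] := leP u p.2; rewrite /= ?mul0r ?mul1r.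
    by rewrite (le_trans up)//; case/andP: pT.
  by case: ifP.
rewrite -[RHS]/(ip mu D h (fun x => \sum_(p <- k) p.1 * kernel_family p.2 x)).
rewrite [RHS]ipC ip_suml//; last by move=> p /ok ?; apply: sqintZ => //; exact: sqe.
rewrite big_seq [RHS]big_seq; apply: eq_bigr => p pk.
by rewrite ipZl ?(ipC _ _ h)//; exact/sqe/ok.
Qed.

End kernel_side.

(** * Wiener integrals of smoothed steps *)

Section fbm_side.
Context (R : realType) (d : measure_display) (Omega : measurableType d)
  (P : probability Omega R) (H : R) (hH : 0 < H < 1)
  (B : R -> {RV P >-> R}) (hB : is_fbm H B).
Local Notation sq := (sqint P setT).
Local Notation nrm := (L2norm P setT).

Lemma fbm_sqint t : 0 <= t -> sq (B t).
Proof.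
move=> t0; split => //; have := fbm_covE hB t0 t0; rewrite unlock /= => e.
by under eq_integral do rewrite expr2; rewrite e ltry.
Qed.

Lemma fbm_ip t s : 0 <= t -> 0 <= s -> ip P setT (B t) (B s) = fbm_cov H t s.
Proof.
by move=> t0 s0; rewrite /ip /Rintegral; have := fbm_covE hB t0 s0; rewrite unlock /= => ->.
Qed.

Lemma fbm_integral t : 0 <= t -> \int[P]_w B t w = 0.
Proof.
by move=> t0; rewrite /Rintegral; have := fbm_mean hB t0; rewrite unlock /= => ->.
Qed.

Let It (T : R) t : 0 <= t <= T -> 0 <= t. Proof. by case/andP. Qed.

Context (T eta : R) (eta01 : 0 < eta <= 1) (g : step R) (og : step_on T g).

Let eta01' : 0 <= eta <= 1. Proof. by case/andP: eta01 => /ltW -> ->. Qed.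

Let sqe t : 0 <= t <= T -> sq (B t). Proof. by move=> /It; exact: fbm_sqint. Qed.

Let ipe t s : 0 <= t <= T -> 0 <= s <= T -> ip P setT (B t) (B s) = fbm_cov H t s.
Proof. by move=> /It t0 /It s0; exact: fbm_ip. Qed.

Lemma step_integral_sqint k : step_on T k -> sq (step_integral B k).
Proof. exact: (lin_on_sqint measurableT sqe). Qed.

Lemma smooth_calH : calH H T (smooth eta T g).
Proof.
have os n : step_on T (smooth eta T g n) by exact: step_on_smooth.
split=> // e e0; set C := smoothing_error H T eta g.
have : (fun n => (C * half_pow H ^+ n) * (C * half_pow H ^+ n)) @ \oo --> 0.
  by rewrite -[X in _ --> X](mulr0 (0 : R)); apply: cvgM; exact: cvg_half_pow.
move=> /cvgr0Pnorm_lt /(_ e e0) [N _ hN]; exists N.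
have /andP[h0 h1] := half_pow_itv hH.
have one n m : (N <= n)%N -> (n <= m)%N ->
    ip P setT (fun w => step_comb (fun t => B t) (smooth eta T g m) w - step_comb (fun t => B t) (smooth eta T g n) w)
      (fun w => step_comb (fun t => B t) (smooth eta T g m) w - step_comb (fun t => B t) (smooth eta T g n) w) < e.
  move=> Nn nm; have := hN n Nn; apply: le_lt_trans.
  rewrite ger0_norm; last by rewrite -expr2 sqr_ge0.
  rewrite -L2norm_sqr expr2 ler_pM ?L2norm_ge0// -half_powX.
    exact: (smooth_cauchy hH measurableT sqe ipe).
  exact: (smooth_cauchy hH measurableT sqe ipe).
have stepE m n : step_ip H (step_sub (smooth eta T g m) (smooth eta T g n))
      (step_sub (smooth eta T g m) (smooth eta T g n)) =
    ip P setT (fun w => step_comb (fun t => B t) (smooth eta T g m) w - step_comb (fun t => B t) (smooth eta T g n) w)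
      (fun w => step_comb (fun t => B t) (smooth eta T g m) w - step_comb (fun t => B t) (smooth eta T g n) w).
  rewrite -lin_sub -(@lin_ip _ _ _ _ P setT measurableT [set t | 0 <= t <= T] (fun t => B t : Omega -> R))//.
  - by apply: on_sub => p; exact: os.
  - by apply: on_sub => p; exact: os.
move=> m n Nm Nn; rewrite stepE; have [nm|/ltnW mn] := leqP n m; first exact: one.
have := one _ _ Nm mn; congr (_ < _); apply: eq_Rintegral => w _; ring.
Qed.

(** The last bound is what lets eta tend to 0. *)
Lemma smooth_wiener_integral : exists Z : {RV P >-> R},
  [/\ sq Z, is_wiener_integral B (smooth eta T g) Z,
    (forall n, nrm (fun w => Z w - step_integral B (smooth eta T g n) w)
      <= smoothing_error H T eta g * half_pow H ^+ n) &
    nrm (fun w => Z w - step_integral B g w) <= 2 * smoothing_error H T eta g].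
Proof.
have [F sF hF] := smooth_limit hH measurableT sqe ipe eta01' og.
have sqs n : sq (step_integral B (smooth eta T g n)).
  by apply: step_integral_sqint; exact: step_on_smooth.
have mF : measurable_fun setT F by case: sF.
pose mixF := isMeasurableFun.Build _ _ _ _ _ mF.
pose Z : {RV P >-> R} := HB.pack F mixF.
exists Z; split => //.
- rewrite /is_wiener_integral unlock.
  exact: (cvg_L2norm0 hH measurableT (fun n => sqintB measurableT sF (sqs n)) hF).
have sg := step_integral_sqint og.
have -> : (fun w => Z w - step_integral B g w) =
  (fun w => (F w - step_integral B (smooth eta T g 0) w)
          + (step_integral B (smooth eta T g 0) w - step_integral B g w)).
  by apply/funext => w; rewrite addrA subrK.
apply: (le_trans (L2normD measurableT _ _)); [exact: sqintB|exact: sqintB|].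
have := hF 0%N; rewrite expr0 mulr1 => h1.
have h2 := smooth_close hH measurableT sqe ipe eta01' og 0.
by rewrite mulr_natl mulr2n lerD.
Qed.

End fbm_side.

(** * Cosines of random variables *)

Section cosines.
Context (R : realType).

Lemma cos_lipschitz (x y : R) : `|cos x - cos y| <= `|x - y|.
Proof.
wlog yx : x y / y <= x.
  move=> h; have [/h//|/ltW/h] := leP y x.
  by rewrite distrC (distrC y).
have [c _ ->] := @MVT_segment R cos (fun z => - sin z) y x yx
  (fun z _ => is_derive_cos z) (continuous_subspaceT (@continuous_cos R)).
by rewrite normrM normrN ler_piMl// sin_max.
Qed.

(** The test functions f; they are functions of a row vector of length 1 since
    one Wiener integral is enough, linear combinations being taken inside it. *)
Definition cos1 (a lam th : R) (x : 'rV[R]_1) : R := a * cos (lam * x 0 0 + th).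

Lemma is_derive_cos1 a lam th (x : 'rV[R]_1) (i : 'I_1) :
  is_derive x (delta_mx 0 i : 'rV[R]_1) (cos1 a lam th) (cos1 (a * lam) lam (th + pi / 2) x).
Proof.
pose G (y : R) := a * cos (lam * y + th).
have dG : is_derive (x 0 0) (1 : R) G (cos1 (a * lam) lam (th + pi / 2) x).
  have l : is_derive (x 0 0) (1 : R) (fun y => lam * y + th) lam.
    by apply: is_derive_eq; rewrite /GRing.scale /=; ring.
  have c := @is_derive1_comp _ cos (fun y => lam * y + th) _ _ _ (is_derive_cos _) l.
  have z := is_deriveZ a c.
  apply: (is_derive_eq z); rewrite /cos1 addrA cosDpihalf /GRing.scale /=; ring.
have E : (fun h : R => h^-1 *: ((cos1 a lam th \o shift x) (h *: delta_mx 0 i) - cos1 a lam th x)) =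
    (fun h : R => h^-1 *: ((G \o shift (x 0 0)) (h *: (1 : R)) - G (x 0 0))).
  apply/funext => h; rewrite /cos1 /G /=; congr (_ *: (_ * cos (_ * _ + _) - _)).
  by rewrite !mxE ord1 !eqxx.
case: dG => dG eG; constructor.
  by move: dG; rewrite /derivable E.
by move: eG; rewrite /derive E.
Qed.

Lemma partial_cos1 a lam th i :
  partial i (cos1 a lam th) = cos1 (a * lam) lam (th + pi / 2).
Proof. by apply/funext => x; have [_ e] := is_derive_cos1 a lam th x i. Qed.

(** A derivative multiplies the amplitude by lam and advances the phase. *)
Lemma Cb_infty_cos1 a lam th : Cb_infty (cos1 a lam th).
Proof.
move=> s; have [a' [th' ->]] : exists a' th', iter_partial s (cos1 a lam th) = cos1 a' lam th'.
  elim: s => [|i s [a' [th' /= ->]]]; first by exists a, th.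
  by exists (a' * lam), (th' + pi / 2); rewrite partial_cos1.
split=> [x i|]; first by have [] := is_derive_cos1 a' lam th' x i.
exists `|a'| => x; rewrite normrM -[leRHS]mulr1 ler_wpM2l//; exact: cos_max.
Qed.

End cosines.

Section cosines_of_random_variables.
Context (R : realType) (d : measure_display) (Omega : measurableType d)
  (P : probability Omega R).
Local Notation sq := (sqint P setT).
Local Notation nrm := (L2norm P setT).
Implicit Types (W Z : Omega -> R).

Lemma measurable_cos_affine lam th Z : measurable_fun setT Z ->
  measurable_fun setT (fun w => cos (lam * Z w + th)).
Proof.
move=> mZ; have mcos : measurable_fun setT (@cos R).
  by apply: continuous_measurable_fun => x; exact: continuous_cos.
by apply: (measurableT_comp mcos); apply: measurable_funD => //; exact: measurable_funM.
Qed.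

Lemma sqint_measurable W : sq W -> measurable_fun setT W.
Proof. by case. Qed.

Lemma sqint_bounded W M : measurable_fun setT W -> (forall w, `|W w| <= M) -> sq W.
Proof.
move=> mW hW; apply: integrable_sqint => //.
have i1 : P.-integrable setT (EFin \o (fun=> M ^+ 2)).
  exact: finite_measure_integrable_cst.
apply: le_integrable i1 => //; first by apply/measurable_EFinP; exact: measurable_funX.
move=> w _ /=; rewrite lee_fin normrX [leRHS]ger0_norm ?sqr_ge0//.
by rewrite !expr2 ler_pM.
Qed.

Lemma sqint_integrable1 W : sq W -> P.-integrable setT (EFin \o W).
Proof.
move=> sW; have s1 : sq (fun=> 1) by apply: (sqint_bounded (M := 1)) => // w; rewrite normr1.
have := sqint_mul measurableT sW s1.
by under eq_fun do rewrite mulr1.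
Qed.

Lemma L2norm_abs W : nrm (fun w => `|W w|) = nrm W.
Proof.
by congr Num.sqrt; apply: eq_Rintegral => w _; rewrite -normrM ger0_norm// -expr2 sqr_ge0.
Qed.

Lemma integrable_mul_cos W Z lam th : sq W -> measurable_fun setT Z ->
  P.-integrable setT (fun w => (W w * cos (lam * Z w + th))%:E).
Proof.
move=> sW mZ; apply: (integrable_mul_bounded measurableT (M := 1)).
- exact: sqint_integrable1.
- exact: measurable_cos_affine.
- by move=> w _; exact: cos_max.
Qed.

(** The cosine is 1-Lipschitz; then the Cauchy-Schwarz inequality. *)
Lemma Rintegral_cos_close W Z Z' lam th : sq W -> sq Z -> sq Z' ->
  `|\int[P]_w (W w * cos (lam * Z w + th)) - \int[P]_w (W w * cos (lam * Z' w + th))|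
  <= `|lam| * nrm W * nrm (fun w => Z w - Z' w).
Proof.
move=> sW sZ sZ'.
have i1 := integrable_mul_cos lam th sW (sqint_measurable sZ).
have i2 := integrable_mul_cos lam th sW (sqint_measurable sZ').
rewrite -RintegralB//.
have sB := sqintB measurableT sZ sZ'.
have sabs V : sq V -> sq (fun w => `|V w|).
  move=> [mV fV]; split; first exact: measurableT_comp.
  by under eq_integral do rewrite -normrX ger0_norm ?sqr_ge0//.
apply: (le_trans (le_normr_Rintegral _ _)) => //.
  exact: (integrableB measurableT i1 i2).
have iabs := sqint_mul measurableT (sabs _ sW) (sabs _ sB).
apply: (@le_trans _ _ (\int[P]_w (`|lam| * (`|W w| * `|Z w - Z' w|)))).
  apply: le_Rintegral => //.
  - exact: (integrable_abse (integrableB measurableT i1 i2)).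
  - exact: (integrableZl measurableT `|lam| iabs).
  - move=> w _; rewrite -mulrBr normrM mulrCA ler_wpM2l//.
    rewrite (le_trans (cos_lipschitz _ _))//.
    rewrite -normrM (_ : _ - _ = lam * (Z w - Z' w))//; ring.
rewrite RintegralZl// -mulrA ler_wpM2l//.
have := ip_le_norm measurableT (sabs _ sW) (sabs _ sB).
by rewrite !L2norm_abs; apply: le_trans; rewrite ler_norm.
Qed.

End cosines_of_random_variables.

(** * Duality and scaling of time *)

Section scaling_of_integrals.
Context (R : realType).
Local Notation mu := (@lebesgue_measure R).

Lemma Rintegral_scale a (f : R -> R) : 0 < a ->
  mu.-integrable setT (EFin \o f) ->
  \int[mu]_x f x = a * \int[mu]_x f (a * x).
Proof.
move=> a0 intf.
have mf : measurable_fun setT (EFin \o f) by exact: measurable_int intf.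
have aE : forall F : R -> \bar R, measurable_fun setT F -> (forall x, 0 <= F x)%E ->
    (\int[mu]_x F x)%E \is a fin_num ->
    exists2 v : R, (\int[mu]_x F (a * x)%R = v%:E)%E & (\int[mu]_x F x = (a * v)%:E)%E.
  move=> F mF F0 Ffin.
  have := ge0_integral_affine 0 a0 mF F0.
  under [X in (_ * X)%E]eq_integral do rewrite addr0.
  have i0 : (0 <= \int[mu]_x F (a * x)%R)%E by exact: integral_ge0.
  move: i0; case E : (\int[mu]_x F (a * x)%R)%E => [v| |] // _ e; first by exists v.
  by move: Ffin; rewrite e gt0_muley ?lte_fin// fin_numE.
have pfin := integrable_fin_num measurableT (integrable_funepos measurableT intf).
have nfin := integrable_fin_num measurableT (integrable_funeneg measurableT intf).
have [v1 e1 e1'] := aE _ (measurable_funepos mf) (fun x => funepos_ge0 _ x) pfin.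
have [v2 e2 e2'] := aE _ (measurable_funeneg mf) (fun x => funeneg_ge0 _ x) nfin.
rewrite /Rintegral integralE e1' e2' [in RHS]integralE.
have -> : (\int[mu]_x ((fun x => (f (a * x)%R)%:E)^\+ x) = v1%:E)%E.
  by rewrite -e1; apply: eq_integral => x _; rewrite !funeposE.
have -> : (\int[mu]_x ((fun x => (f (a * x)%R)%:E)^\- x) = v2%:E)%E.
  by rewrite -e2; apply: eq_integral => x _; rewrite !funenegE.
by rewrite /= mulrBr.
Qed.

Lemma Rintegral_scale_itv a T (f : R -> R) : 0 < a ->
  mu.-integrable `[0, a * T] (EFin \o f) ->
  \int[mu]_(x in `[0, a * T]) f x = a * \int[mu]_(x in `[0, T]) f (a * x).
Proof.
move=> a0 intf; rewrite Rintegral_mkcond (Rintegral_scale a0); last first.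
  have := (@integrable_mkcond _ _ _ mu `[0, a * T] (EFin \o f) (measurable_itv _)).1 intf.
  by rewrite restrict_EFin.
congr (_ * _); rewrite [RHS]Rintegral_mkcond; apply: eq_Rintegral => x _.
rewrite !patchE !mem_setE !in_itv/= pmulr_rge0// ler_pM2l//.
Qed.

End scaling_of_integrals.

Section sign_correlation.
Context (R : realType) (d : measure_display) (Omega : measurableType d)
  (P : probability Omega R).
Local Notation mu := (@lebesgue_measure R).

(** Tonelli's theorem for the nonnegative integrand 1 + u S. *)
Lemma measurable_partial_expectation (T : R) (u : R -> Omega -> R) (S : Omega -> R) :
  measurable_fun (`[0, T] `*` setT) (fun p : R * Omega => u p.1 p.2) ->
  (forall s, measurable_fun setT (u s)) ->
  (forall s w, `|u s w| <= 1) -> measurable_fun setT S -> (forall w, `|S w| <= 1) ->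
  measurable_fun `[0, T] (fun s => \int[P]_w (u s w * S w)).
Proof.
move=> mu_ mus u1 mS S1.
have mI : measurable (`[0, T] : set R) by exact: measurable_itv.
have mD : measurable (`[0, T] `*` setT : set (R * Omega)) by exact: measurableX.
pose G := (fun p : R * Omega => (1 + u p.1 p.2 * S p.2)%:E) \_ (`[0, T] `*` setT).
have mG : measurable_fun setT G.
  apply/(measurable_restrictT _ mD)/measurable_EFinP.
  apply: measurable_funD => //; apply: measurable_funM => //.
  apply: measurable_funTS; exact: (measurableT_comp mS measurable_snd).
have uS s w : `|u s w * S w| <= 1 by rewrite normrM mulr_ile1.
have G0 p : (0 <= G p)%E.
  rewrite /G patchE; case: ifP => // _; rewrite lee_fin.
  by have := uS p.1 p.2; rewrite ler_norml => /andP[]; lra.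
have mF := @measurable_fun_fubini_tonelli_F _ _ _ _ _ P _ mG G0.
have iUS s : P.-integrable setT (fun w => (u s w * S w)%:E).
  apply: sqint_integrable1; apply: (@sqint_bounded _ _ _ P _ 1) => //.
  exact: measurable_funM.
have FE s : `[0, T]%classic s -> fubini_F P G s = (1 + \int[P]_w (u s w * S w))%:E.
  move=> sT; rewrite /fubini_F.
  have -> : (fun w => G (s, w)) = (fun w => (1 + u s w * S w)%:E).
    by apply/funext => w; rewrite /G patchE mem_set.
  have i1 : P.-integrable setT (EFin \o (fun=> 1 : R)) by exact: finite_measure_integrable_cst.
  rewrite -[LHS]fineK; last exact: (integrable_fin_num measurableT (integrableD measurableT i1 (iUS s))).
  congr EFin; rewrite -[LHS]/(\int[P]_w (1 + u s w * S w)) RintegralD//; last exact: iUS.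
  by rewrite Rintegral_const.
have m1 : measurable_fun `[0, T] (fun s => fine (fubini_F P G s) - 1).
  apply: measurable_funTS; apply: measurable_funB => //.
  exact: (measurableT_comp (fine_measurable measurableT) mF).
have e : {in `[0, T]%classic, (fun s => fine (fubini_F P G s) - 1) =1
    (fun s => \int[P]_w (u s w * S w))}.
  by move=> v /set_mem vT; rewrite FE//= addrAC subrr add0r.
exact: (@eq_measurable_fun _ _ _ _ _ _ _ e m1).
Qed.

End sign_correlation.

Section duality_for_cosines.
Context (R : realType) (d : measure_display) (Omega : measurableType d)
  (P : probability Omega R) (H : R) (hH : 0 < H < 1)
  (K : R -> R -> R) (hK : volterra_kernel H K)
  (B : R -> {RV P >-> R}) (hB : is_fbm H B).
Local Notation mu := (@lebesgue_measure R).
Local Notation sq := (sqint P setT).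

Definition sign_cos lam th (Z : Omega -> R) (t : R) : R :=
  \int[P]_w (Num.sg (B t w) * cos (lam * Z w + th)).

Lemma expectationE (X : Omega -> R) : ('E_P[X] = \int[P]_w (X w)%:E)%E.
Proof. by rewrite unlock. Qed.

Lemma measurable_sg (f : Omega -> R) : measurable_fun setT f ->
  measurable_fun setT (fun w => Num.sg (f w)).
Proof.
move=> mf; have -> : (fun w => Num.sg (f w)) =
    (fun w => if 0 < f w then 1 else if f w < 0 then -1 else 0).
  by apply/funext => w; case: sgrP => // ->; rewrite ltxx.
apply: measurable_fun_ifT => //; first exact: measurable_fun_ltr.
by apply: measurable_fun_ifT => //; exact: measurable_fun_ltr.
Qed.

Lemma sg_le1 (x : R) : `|Num.sg x| <= 1.
Proof. by rewrite normr_sg; case: (_ != _). Qed.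

Lemma sign_sqint t : sq (fun w => Num.sg (B t w)).
Proof.
apply: (@sqint_bounded _ _ _ P _ 1); [exact: measurable_sg|move=> w; exact: sg_le1].
Qed.

Lemma sign_cos_bound lam th (Z : {RV P >-> R}) t : `|sign_cos lam th Z t| <= 1.
Proof.
have i1 := integrable_mul_cos lam th (sign_sqint t) (measurable_funP Z).
apply: (le_trans (le_normr_Rintegral measurableT i1)).
rewrite -[leRHS](Rintegral_const P); apply: le_Rintegral => //.
- exact: (integrable_abse i1).
- exact: finite_measure_integrable_cst.
- by move=> w _; rewrite normrM mulr_ile1// ?sg_le1// cos_max.
Qed.

Section fixed_horizon.
Context (T : R) (T0 : 0 < T) (D : {RV P >-> R})
  (hD : is_divergence H K B T (fun s w => Num.sg (B s w)) D).
Context (eta : R) (eta01 : 0 < eta <= 1) (g : step R) (og : step_on T g).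

Lemma divergence_sqint : sq D.
Proof.
split => //; have := div_L2 hD => /Lfun2_integrable_sqr/integrableP[_].
by apply: le_lt_trans; apply: ge0_le_integral => //; [
  move=> w _; rewrite lee_fin sqr_ge0
| apply/measurable_EFinP; exact: measurable_funX
| do 2 apply: measurableT_comp => //; exact: measurable_funX
| move=> w _; rewrite /= lee_fin ler_norm].
Qed.

(** The phase pi / 2 comes from the derivative of the cosine. *)
Lemma divergence_cos lam th (Z : {RV P >-> R}) :
  is_wiener_integral B (smooth eta T g) Z ->
  \int[P]_w (D w * cos (lam * Z w + th)) =
  \int[mu]_(t in `[0, T]) (lam * test_density H eta T g t * sign_cos lam (th + pi / 2) Z t).
Proof.
move=> hZ; have hK2 := smooth_KstaraKstar hH hK T0 eta01 og.
have dual := @div_duality _ _ _ _ _ _ _ _ _ _ hD 0 (cos1 1 lam th)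
  (fun=> smooth eta T g) (fun=> Z) (fun=> test_density H eta T g)
  (Cb_infty_cos1 1 lam th)
  (fun=> conj (smooth_calH hH hB eta01 og) (ex_intro _ _ hK2)) (fun=> hZ) (fun=> hK2).
rewrite /Rintegral.
have -> : (\int[P]_w (D w * cos (lam * Z w + th))%:E)%E =
    ('E_P[fun w => (D w * smooth_rv (cos1 1 lam th) (fun=> Z) w)%R])%E.
  rewrite expectationE; apply: eq_integral => w _.
  by rewrite /smooth_rv /cos1 mxE mul1r.
rewrite -dual; congr fine; apply: eq_integral => t _.
have mZ : measurable_fun setT Z by [].
have i1 := integrable_mul_cos lam (th + pi / 2) (sign_sqint t) mZ.
rewrite expectationE /sign_cos -RintegralZl// /Rintegral fineK.
  apply: eq_integral => w _; rewrite /KKD big_ord1 partial_cos1 /cos1 mxE; congr EFin; ring.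
exact: (integrable_fin_num measurableT (integrableZl measurableT _ i1)).
Qed.

End fixed_horizon.
End duality_for_cosines.

(** * Self-similarity *)

Definition step_scale (R : realType) (a : R) (g : step R) : step R :=
  [seq (p.1, a * p.2) | p <- g].

Lemma step_on_scale (R : realType) (a T : R) (g : step R) : 0 < a ->
  step_on T g -> step_on (a * T) (step_scale a g).
Proof.
move=> a0 og q /mapP[p /og /andP[p0 pT] ->] /=.
by rewrite mulr_ge0 ?(ltW a0)//= ler_pM2l.
Qed.

Section rescaled_process.
Context (R : realType) (d : measure_display) (Omega : measurableType d)
  (P : probability Omega R) (H : R)
  (B : R -> {RV P >-> R}) (hB : is_fbm H B) (a : R) (a0 : 0 < a).
Local Notation sq := (sqint P setT).
Local Notation N2 f := (ip P setT f f).

Lemma rescaled_exists :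
  exists V : R -> {RV P >-> R}, forall t w, V t w = a `^ (- H) * B (a * t) w.
Proof.
have /choice[V hV] : forall t, exists U : {RV P >-> R},
    (U : Omega -> R) = (fun w => a `^ (- H) * B (a * t) w).
  move=> t; have mU : measurable_fun setT (fun w => a `^ (- H) * B (a * t) w).
    exact: measurable_funM.
  pose mix := isMeasurableFun.Build _ _ _ _ _ mU.
  by exists (HB.pack (fun w => a `^ (- H) * B (a * t) w) mix : {RV P >-> R}).
by exists V => t w; rewrite hV.
Qed.

Context (V : R -> {RV P >-> R}) (VE : forall t w, V t w = a `^ (- H) * B (a * t) w).

Lemma step_eval_rescaled g w :
  step_eval g (sample_path V w) = a `^ (- H) * step_integral B (step_scale a g) w.
Proof.
rewrite /step_eval /step_integral /step_scale big_map mulr_sumr.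
by apply: eq_bigr => p _ /=; rewrite /sample_path VE mulrCA.
Qed.

Lemma rescaled_fun t : (V t : Omega -> R) = (fun w => a `^ (- H) * B (a * t) w).
Proof. by apply/funext => w; exact: VE. Qed.

Lemma rescaled_sqint t : 0 <= t -> sq (V t).
Proof.
move=> t0; rewrite rescaled_fun; apply: sqintZ => //.
by apply: (fbm_sqint hB); rewrite mulr_ge0// ltW.
Qed.

Lemma rescaled_ip t s : 0 <= t -> 0 <= s -> ip P setT (V t) (V s) = fbm_cov H t s.
Proof.
move=> t0 s0; have at0 : 0 <= a * t by rewrite mulr_ge0// ltW.
have as0 : 0 <= a * s by rewrite mulr_ge0// ltW.
have st := fbm_sqint hB at0; have ss := fbm_sqint hB as0.
rewrite !rescaled_fun ipZl//; last exact: sqintZ.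
rewrite ipC ipZl// ipC (fbm_ip hB)// fbm_cov_scale// mulrA mulrA -powRD; last first.
  by rewrite (gt_eqF a0) implybT.
rewrite -powRD; last by rewrite (gt_eqF a0) implybT.
by rewrite (_ : - H + - H + 2 * H = 0) ?powRr0 ?mul1r//; ring.
Qed.

Lemma step_integral_gaussian c g : (forall p, p \in g -> 0 <= p.2) ->
  gaussian_rv P (fun w => c * step_integral B g w).
Proof.
move=> hg; have := fbm_gaussian hB (n := size g)
  (t := fun i => (nth (0, 0) g i).2) (fun i => c * (nth (0, 0) g i).1).
have -> : (fun w => \sum_(i < size g) c * (nth (0, 0) g i).1 * B (nth (0, 0) g i).2 w) =
    (fun w => c * step_integral B g w).
  apply/funext => w; rewrite /step_integral mulr_sumr (big_nth (0, 0)) big_mkord.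
  by apply: eq_bigr => i _; rewrite mulrA.
by apply => i; apply: hg; exact: mem_nth.
Qed.

(** The two linear combinations are centered Gaussian variables with the same
    variance. *)
Lemma rescaled_cos g th : (forall p, p \in g -> 0 <= p.2) ->
  \int[P]_w cos (step_eval g (sample_path V w) + th) =
  \int[P]_w cos (step_eval g (sample_path B w) + th).
Proof.
move=> hg; pose I := [set t : R | 0 <= t].
have sV : sq (step_comb (fun t => V t) g).
  by apply: (@lin_sqint _ _ _ _ _ measurableT I) => // t; exact: rescaled_sqint.
have sB : sq (step_comb (fun t => B t) g).
  by apply: (@lin_sqint _ _ _ _ _ measurableT I) => // t; exact: (fbm_sqint hB).
have mV : measurable_fun setT (fun w => step_eval g (sample_path V w)) by case: sV.
have mB : measurable_fun setT (fun w => step_eval g (sample_path B w)) by case: sB.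
pose mixV := isMeasurableFun.Build _ _ _ _ _ mV.
pose mixB := isMeasurableFun.Build _ _ _ _ _ mB.
pose ZV : {RV P >-> R} := HB.pack (fun w => step_eval g (sample_path V w)) mixV.
pose ZB : {RV P >-> R} := HB.pack (fun w => step_eval g (sample_path B w)) mixB.
have hg' p : p \in step_scale a g -> 0 <= p.2.
  by move=> /mapP[q /hg q0 ->] /=; rewrite mulr_ge0// ltW.
have one : sq (fun=> 1) by apply: (@sqint_bounded _ _ _ P _ 1) => // w; rewrite normr1.
have mean c k : (forall p, p \in k -> 0 <= p.2) ->
    \int[P]_w (c * step_integral B k w) = 0.
  move=> hk; have sk : sq (step_integral B k).
    by apply: (@lin_sqint _ _ _ _ _ measurableT I (fun t => B t)) => // t; exact: (fbm_sqint hB).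
  rewrite RintegralZl//; last exact: sqint_integrable1.
  have -> : \int[P]_w step_integral B k w = ip P setT (fun w => \sum_(p <- k) p.1 * B p.2 w) (fun=> 1).
    by apply: eq_Rintegral => w _; rewrite mulr1.
  rewrite ip_suml//; last first.
    by move=> p /hk p0; apply: sqintZ => //; exact: (fbm_sqint hB).
  rewrite big_seq big1 ?mulr0// => p /hk p0; rewrite ipZl//; last exact: (fbm_sqint hB).
  rewrite (_ : ip _ _ _ _ = 0) ?mulr0//.
  by rewrite -(fbm_integral hB p0); apply: eq_Rintegral => w _; rewrite mulr1.
apply: (same_distribution_cos th (V := ZV) (W := ZB)).
apply: centered_gaussian_law => //.
- have := step_integral_gaussian (a `^ (- H)) hg'.
  by congr (gaussian_rv P); apply/funext => w; rewrite -step_eval_rescaled.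
- have := step_integral_gaussian 1 hg.
  by congr (gaussian_rv P); apply/funext => w; rewrite mul1r.
- rewrite -(mean (a `^ (- H)) _ hg'); apply: eq_Rintegral => w _.
  exact: step_eval_rescaled.
- rewrite -(mean 1 _ hg); apply: eq_Rintegral => w _; by rewrite mul1r.
- rewrite -[LHS]/(ip P setT (step_comb (fun t => V t) g) (step_comb (fun t => V t) g)).
  rewrite -[RHS]/(ip P setT (step_comb (fun t => B t) g) (step_comb (fun t => B t) g)).
  rewrite (@lin_ip _ H _ _ P setT measurableT I (fun t => V t : Omega -> R))//; last 2 first.
  + by move=> t; exact: rescaled_sqint.
  + by move=> t s; exact: rescaled_ip.
  rewrite (@lin_ip _ H _ _ P setT measurableT I (fun t => B t : Omega -> R))//.
  + by move=> t; exact: (fbm_sqint hB).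
  + by move=> t s; exact: (fbm_ip hB).
Qed.

Lemma step_integral_smooth_scale eta T g n w :
  a `^ (- H) * step_integral B (smooth eta (a * T) (step_scale a g) n) w =
  step_eval (smooth eta T g n) (sample_path V w).
Proof.
have nodeE t s : node eta (a * T) (a * t) s = a * node eta T t s.
  by rewrite /node; ring.
have node0 s : node eta (a * T) 0 s = a * node eta T 0 s.
  by rewrite -nodeE mulr0.
rewrite -[step_integral _ _ _]/(step_comb (fun t => B t) _ w).
rewrite -[RHS]/(step_comb (fun t => V t) (smooth eta T g n) w).
rewrite !lin_smooth mulr_sumr; apply: eq_bigr => k _.
rewrite mulrCA !lin_shift big_map mulr_sumr; congr (_ * _); apply: eq_bigr => p _ /=.
by rewrite !VE nodeE node0; ring.
Qed.

End rescaled_process.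

Section comparison.
Context (R : realType) (d : measure_display) (Omega : measurableType d)
  (P : probability Omega R) (H : R) (hH : 0 < H < 1)
  (K : R -> R -> R) (hK : volterra_kernel H K)
  (B : R -> {RV P >-> R}) (hB : is_fbm H B)
  (X : R -> {RV P >-> R})
  (hX : forall t, 0 < t ->
      is_divergence H K B t (fun s w => Num.sg (B s w)) (X t)).
Context (a : R) (a0 : 0 < a) (V : R -> {RV P >-> R})
  (VE : forall t w, V t w = a `^ (- H) * B (a * t) w).
Local Notation mu := (@lebesgue_measure R).
Local Notation sq := (sqint P setT).
Local Notation nrm := (L2norm P setT).

Lemma same_trig F : trig_class `[0, +oo[ F ->
  \int[P]_w F (sample_path V w) = \int[P]_w F (sample_path B w).
Proof.
apply: same_law_trig => g th hg; apply: (rescaled_cos hB a0 VE) => p /hg /=.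
by rewrite in_itv/= andbT.
Qed.

Section fixed_test.
Context (T : R) (T0 : 0 < T) (eta : R) (eta01 : 0 < eta <= 1) (g : step R) (og : step_on T g).
Context (Z Z' : {RV P >-> R}) (sZ : sq Z) (sZ' : sq Z').
Hypotheses
  (hZ : forall n, nrm (fun w => Z w - step_integral B (smooth eta T g n) w)
      <= smoothing_error H T eta g * half_pow H ^+ n)
  (hZ' : forall n, nrm (fun w => Z' w - step_integral B (smooth eta (a * T) (step_scale a g) n) w)
      <= smoothing_error H (a * T) eta (step_scale a g) * half_pow H ^+ n).

Let eta01' : 0 <= eta <= 1. Proof. by case/andP: eta01 => /ltW -> ->. Qed.
Let aT0 : 0 < a * T. Proof. exact: mulr_gt0. Qed.
Let og' := step_on_scale a0 og.

(** The pair formed by the process and its smoothed Wiener integral has the same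
    law before and after rescaling: pass to the limit in the step functions. *)
Lemma sign_cos_scale th u : 0 <= u <= T ->
  sign_cos B (a `^ (- H)) th Z' (a * u) = sign_cos B 1 th Z u.
Proof.
move=> /andP[u0 uT].
pose F n x := Num.sg (x u - 0) * cos (step_eval (smooth eta T g n) x + th).
have cF n : trig_class `[0, +oo[ (F n).
  apply: trigM; first by apply: trig_sg_coord; rewrite /= in_itv/= u0.
  apply: trig_cos => p /(step_on_smooth eta01' og) /andP[p0 _].
  by rewrite /= in_itv/= p0.
have sqs T' k n : step_on T' k -> sq (step_integral B (smooth eta T' k n)).
  move=> ok; apply: (@step_integral_sqint _ _ _ _ _ _ hB T'); exact: step_on_smooth.
have c1 : (fun n => \int[P]_w F n (sample_path B w)) @ \oo --> sign_cos B 1 th Z u.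
  apply: (cvg_half_pow_bound hH
    (c := `|1| * nrm (fun w => Num.sg (B u w)) * smoothing_error H T eta g)) => n.
  have := Rintegral_cos_close 1 th (sign_sqint B u) sZ (sqs _ _ n og).
  rewrite distrC => h.
  have e : \int[P]_w F n (sample_path B w) =
      \int[P]_w (Num.sg (B u w) * cos (1 * step_integral B (smooth eta T g n) w + th)).
    by apply: eq_Rintegral => w _; rewrite /F subr0 mul1r.
  rewrite e; apply: (le_trans h).
  rewrite -[leRHS]mulrA; apply: ler_wpM2l; last exact: hZ.
  by rewrite mulr_ge0// L2norm_ge0.
have c2 : (fun n => \int[P]_w F n (sample_path V w)) @ \oo -->
    sign_cos B (a `^ (- H)) th Z' (a * u).
  apply: (cvg_half_pow_bound hH (c := `|a `^ (- H)| * nrm (fun w => Num.sg (B (a * u) w))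
    * smoothing_error H (a * T) eta (step_scale a g))) => n.
  have := Rintegral_cos_close (a `^ (- H)) th (sign_sqint B (a * u)) sZ' (sqs _ _ n og').
  rewrite distrC => h.
  have e : \int[P]_w F n (sample_path V w) =
      \int[P]_w (Num.sg (B (a * u) w) *
        cos (a `^ (- H) * step_integral B (smooth eta (a * T) (step_scale a g) n) w + th)).
    apply: eq_Rintegral => w _.
    rewrite /F subr0 (step_integral_smooth_scale VE) /sample_path VE.
    by rewrite sgrM gtr0_sg ?mul1r// powR_gt0.
  rewrite e; apply: (le_trans h).
  rewrite -[leRHS]mulrA; apply: ler_wpM2l; last exact: hZ'.
  by rewrite mulr_ge0// L2norm_ge0.
have e n : \int[P]_w F n (sample_path V w) = \int[P]_w F n (sample_path B w) by exact: same_trig.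
rewrite (_ : (fun n => \int[P]_w F n (sample_path V w)) =
    (fun n => \int[P]_w F n (sample_path B w))) in c2; last exact/funext.
exact: (cvg_unique _ c2 c1).
Qed.

Let W' := test_density H eta (a * T) (step_scale a g).

Lemma measurable_sign_cos th : measurable_fun `[0, a * T] (sign_cos B (a `^ (- H)) th Z').
Proof.
apply: (@measurable_partial_expectation _ _ _ P (a * T) (fun s w => Num.sg (B s w))).
- exact: div_process_measurable (hX aT0).
- by move=> s; exact: measurable_sg.
- by move=> s w; exact: sg_le1.
- exact: measurable_cos_affine.
- by move=> w; exact: cos_max.
Qed.

(** The substitution s = a u in the duality relation on [0, a T]. The factors
    a^(-H) of the derivative, a^(2H-1) of the density and a of the measure
    combine to a^H. *)
Lemma divergence_cos_scale th :
  is_wiener_integral B (smooth eta T g) Z ->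
  is_wiener_integral B (smooth eta (a * T) (step_scale a g)) Z' ->
  \int[P]_w (X (a * T) w * cos (a `^ (- H) * Z' w + th)) =
  a `^ H * \int[P]_w (X T w * cos (1 * Z w + th)).
Proof.
move=> wZ wZ'.
rewrite (divergence_cos hH hK hB aT0 (hX aT0) eta01 og' (a `^ (- H)) th wZ').
rewrite (divergence_cos hH hK hB T0 (hX T0) eta01 og 1 th wZ).
have mI : measurable (`[0, a * T] : set R) by exact: measurable_itv.
have mI' : measurable (`[0, T] : set R) by exact: measurable_itv.
have msc := measurable_sign_cos (th + pi / 2).
have iW Y k : mu.-integrable `[0, Y] (EFin \o (fun t => test_density H eta Y k t)).
  apply: (@continuous_compact_integrable _ (fun t => test_density H eta Y k t)).
    exact: segment_compact.
  by apply: continuous_subspaceT; exact: continuous_test_density.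
have int1 : mu.-integrable `[0, a * T] (fun t =>
    (W' t * sign_cos B (a `^ (- H)) (th + pi / 2) Z' t)%:E).
  apply: (@integrable_mul_bounded _ _ _ mu `[0, a * T] mI W' _ 1) => //.
  - exact: iW.
  - by move=> x _; exact: sign_cos_bound.
have -> : \int[mu]_(t in `[0, a * T]) (a `^ (- H) * W' t *
      sign_cos B (a `^ (- H)) (th + pi / 2) Z' t) =
    a `^ (- H) * \int[mu]_(t in `[0, a * T]) (W' t *
      sign_cos B (a `^ (- H)) (th + pi / 2) Z' t).
  by rewrite -RintegralZl//; apply: eq_Rintegral => t _; rewrite mulrA.
rewrite Rintegral_scale_itv//.
have -> : \int[mu]_(t in `[0, T]) (W' (a * t) *
      sign_cos B (a `^ (- H)) (th + pi / 2) Z' (a * t)) =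
    \int[mu]_(t in `[0, T]) (a `^ (2 * H) / a * (1 * test_density H eta T g t *
      sign_cos B 1 (th + pi / 2) Z t)).
  apply: eq_Rintegral => t; rewrite inE/= in_itv/= => tT.
  rewrite sign_cos_scale// /W' /step_scale test_density_scale//.
  by rewrite mul1r !mulrA.
have int2 : mu.-integrable `[0, T] (fun t =>
    (1 * test_density H eta T g t * sign_cos B 1 (th + pi / 2) Z t)%:E).
  apply: (@integrable_mul_bounded _ _ _ mu `[0, T] mI'
    (fun t => 1 * test_density H eta T g t) _ 1).
  - by under [X in _.-integrable _ X]eq_fun do rewrite /= mul1r; exact: iW.
  - apply: (@measurable_partial_expectation _ _ _ P T (fun s w => Num.sg (B s w))).
    + exact: div_process_measurable (hX T0).
    + by move=> s; exact: measurable_sg.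
    + by move=> s w; exact: sg_le1.
    + exact: measurable_cos_affine.
    + by move=> w; exact: cos_max.
  - by move=> x _; exact: sign_cos_bound.
rewrite RintegralZl// !mulrA; congr (_ * _).
have an : a != 0 by rewrite gt_eqF.
rewrite -mulrA mulrAC -!mulrA mulVf// mulr1 -powRD; last by rewrite an implybT.
by congr (_ `^ _); ring.
Qed.

End fixed_test.
Lemma smoothing_error_dyadic T g n : 0 <= T ->
  smoothing_error H T (2 ^+ n)^-1 g = smoothing_error H T 1 g * half_pow H ^+ n.
Proof.
move=> T0; rewrite /smoothing_error powRM ?invr_ge0 ?exprn_ge0// half_powX mul1r; ring.
Qed.

(** Let eta = 2^(-n) tend to 0 in the relation for smoothed steps. *)
Lemma divergence_step_cos T g th : 0 < T -> step_on T g ->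
  \int[P]_w (X (a * T) w * cos (step_eval g (sample_path V w) + th)) =
  a `^ H * \int[P]_w (X T w * cos (step_eval g (sample_path B w) + th)).
Proof.
move=> T0 og; have aT0 : 0 < a * T by exact: mulr_gt0.
have og' := step_on_scale a0 og.
set L := LHS; set M := \int[P]_w _.
pose e1 := `|a `^ (- H)| * nrm (X (a * T)) * (2 * smoothing_error H (a * T) 1 (step_scale a g)).
pose e2 := a `^ H * (`|1| * nrm (X T) * (2 * smoothing_error H T 1 g)).
suff c : (fun _ : nat => L) @ \oo --> a `^ H * M.
  have cL : (fun _ : nat => L) @ \oo --> L by exact: cvg_cst.
  exact: (cvg_unique _ cL c).
apply: (cvg_half_pow_bound hH (c := e1 + e2)) => n.
have eta01 : 0 < ((2 : R) ^+ n)^-1 <= 1.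
  apply/andP; split; first by rewrite invr_gt0 exprn_gt0.
  by rewrite invf_le1 ?exprn_gt0// exprn_ege1// ler1n.
have [Z [sZ wZ hZ cZ]] := smooth_wiener_integral hH hB eta01 og.
have [Z' [sZ' wZ' hZ' cZ']] := smooth_wiener_integral hH hB eta01 og'.
have sX t : 0 < t -> sq (X t) by move=> t0; exact: divergence_sqint (hX t0).
have s1 := step_integral_sqint hB og; have s1' := step_integral_sqint hB og'.
have key := divergence_cos_scale T0 eta01 og sZ sZ' hZ hZ' th wZ wZ'.
have b1 := Rintegral_cos_close (a `^ (- H)) th (sX _ aT0) sZ' s1'.
have b2 := Rintegral_cos_close 1 th (sX _ T0) sZ s1.
have LE : L = \int[P]_w (X (a * T) w *
    cos (a `^ (- H) * step_integral B (step_scale a g) w + th)).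
  by apply: eq_Rintegral => w _; rewrite (step_eval_rescaled VE).
have ME : M = \int[P]_w (X T w * cos (1 * step_integral B g w + th)).
  by apply: eq_Rintegral => w _; rewrite mul1r.
rewrite -LE key in b1; rewrite -ME in b2.
set Q := \int[P]_w (X T w * cos (1 * Z w + th)) in b1 b2.
have aH : 0 <= a `^ H by exact: powR_ge0.
have d1 : `|a `^ H * Q - L| <= e1 * half_pow H ^+ n.
  apply: (le_trans b1); rewrite /e1 -[leRHS]mulrA; apply: ler_wpM2l.
    by rewrite mulr_ge0// L2norm_ge0.
  by rewrite -mulrA -smoothing_error_dyadic// ltW.
have d2 : `|a `^ H * Q - a `^ H * M| <= e2 * half_pow H ^+ n.
  rewrite -mulrBr normrM (ger0_norm aH) /e2 -mulrA; apply: ler_wpM2l => //.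
  apply: (le_trans b2); rewrite -[leRHS]mulrA; apply: ler_wpM2l.
    by rewrite mulr_ge0// L2norm_ge0.
  by rewrite -mulrA -smoothing_error_dyadic// ltW.
have -> : L - a `^ H * M = (L - a `^ H * Q) + (a `^ H * Q - a `^ H * M) by ring.
apply: (le_trans (ler_normD _ _)); rewrite mulrDl lerD//.
by rewrite distrC.
Qed.

End comparison.

Theorem proposition2 (R : realType) (d : measure_display)
    (Omega : measurableType d) (P : probability Omega R)
    (H : R) (hH : 0 < H < 1)
    (K : R -> R -> R) (hK : volterra_kernel H K)
    (B : R -> {RV P >-> R}) (hB : is_fbm H B)
    (X : R -> {RV P >-> R})
    (hX0 : {ae P, forall w, X 0 w = 0})
    (hX : forall t, 0 < t ->
      is_divergence H K B t (fun s w => Num.sg (B s w)) (X t)) :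
  self_similar P H (fun t w => X t w).
Proof.
move=> a a0; have [V VE] := rescaled_exists H B a.
have sX t : 0 < t -> sqint P setT (X t) by move=> t0; exact: divergence_sqint (hX t t0).
have at0 t : 0 < t -> 0 < a * t by exact: mulr_gt0.
have /choice[W2 W2E] : forall t, exists U : {RV P >-> R},
    (U : Omega -> R) = (fun w => a `^ H * X t w).
  move=> t; have mU : measurable_fun setT (fun w => a `^ H * X t w).
    exact: measurable_funM.
  pose mix := isMeasurableFun.Build _ _ _ _ _ mU.
  by exists (HB.pack (fun w => a `^ H * X t w) mix : {RV P >-> R}).
have -> : (fun t w => a `^ H * X t w) = (fun t w => W2 t w).
  by apply/funext => t; apply/funext => w; rewrite W2E.
pose W1 t := X (a * t).
apply: (@same_law_functionals _ _ _ P V B W1 W2).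
- move=> g th hg; apply: (rescaled_cos hB a0 VE) => p /hg.
  by rewrite /= in_itv/= andbT.
- by move=> t t0; apply: sqint_integrable1; exact/sX/at0.
- by move=> t t0; rewrite W2E; apply: sqint_integrable1; apply: sqintZ => //; exact: sX.
- move=> t t0 S hS.
  have {hS} := div_measurable (hX _ (at0 t t0)) hS.
  apply: (generated_by_sub (sigma_algebra_generated_by _ _)) => s y /=.
  rewrite in_itv/= => /andP[s0 st].
  have -> : [set w | B s w < y] = V (s / a) @^-1` `]-oo, a `^ (- H) * y[.
    apply/seteqP; split => w /=; rewrite in_itv/= VE mulrCA divff ?gt_eqF// mulr1;
      by rewrite ltr_pM2l// powR_gt0.
  apply: generated_by_preimage => //=.
  by rewrite in_itv/= divr_ge0 ?(ltW a0)//= ler_pdivrMr// mulrC.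
- move=> t t0 _ [Y mY <-]; apply: (div_measurable (hX t t0)).
  exists ((fun x => a `^ H * x) @^-1` Y).
    rewrite -[X in measurable X]setTI.
    have mm : measurable_fun setT (fun x : R => a `^ H * x) by exact: measurable_funM.
    exact: mm.
  by rewrite !setTI W2E.
- move=> t g th t0 hg.
  rewrite (divergence_step_cos hH hK hB hX a0 VE th t0 hg) -RintegralZl//; last first.
    have mS : measurable_fun setT (fun w => step_eval g (sample_path B w)).
      by rewrite /step_eval; apply: measurable_sum => p; exact: measurable_funM.
    move: (integrable_mul_cos 1 th (sX t t0) mS).
    by apply: eq_integrable => // w _; rewrite mul1r.
  by apply: eq_Rintegral => w _; rewrite W2E mulrA.
- by move: hX0; apply: filterS => w; rewrite /W1 mulr0.
- by move: hX0; apply: filterS => w h; rewrite W2E h mulr0.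
Qed.
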